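(* Let $A$ be a unital semisimple commutative Banach algebra and $B$ a unital commutative Banach algebra. Suppose that $T$ is a map from $A^{-1}$ onto $B^{-1}$ such that $$\mathrm{r}(Tf\,Tg-1)=\mathrm{r}(fg-1)$$ holds for every pair $f$ and $g$ in $A^{-1}$. Then $B$ is semisimple and $(T1)^2=1$, and $T$ is extended to a map $T_E$ from $\mathrm{cl}\,A$ onto $\mathrm{cl}\,B$ such that $T_EA=B$, and there exist a homeomorphism $\phi$ from $\mathrm{Ch}(\mathrm{cl}\,B)$ onto $\mathrm{Ch}(\mathrm{cl}\,A)$ and a clopen subset $K$ of $\mathrm{Ch}(\mathrm{cl}\,B)$ such that $$T_Ef(y)=T1(y)\times\begin{cases} f(\phi(y)), & y\in K,\\ \overline{f(\phi(y))}, & y\in\mathrm{Ch}(\mathrm{cl}\,B)\setminus K\end{cases}$$ holds for every $f\in\mathrm{cl}\,A$. In particular, $\frac{T_E}{T1}$ (the map $f\mapsto T_Ef/T1$) is a real-algebra isomorphism from $\mathrm{cl}\,A$ onto $\mathrm{cl}\,B$ and $\frac{T_E}{T1}(A)=B$; $A$ is real-algebraically isomorphic to $B$. Thus the equality $$\|T_Ef\,T_Eg-1\|_{\infty(M_B)}=\|fg-1\|_{\infty(M_A)}$$ holds for every pair $f$ and $g$ in $\mathrm{cl}\,A$, and $T_E((\mathrm{cl}\,A)^{-1})=(\mathrm{cl}\,B)^{-1}$.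
   Context: Banach algebras are over $\mathbb{C}$. $A^{-1}$ is the group of invertible elements of $A$; $\mathrm{r}(\cdot)$ is the spectral radius; $M_A$ is the maximal ideal space of $A$ (compact Hausdorff). $\mathrm{cl}\,A$ is the closure, in the supremum norm $\|\cdot\|_{\infty(M_A)}$, of the Gelfand transform $\hat A$ in $C(M_A)$; it is a uniform algebra on $M_A$, i.e. a uniformly closed subalgebra of $C(M_A)$ containing the constants and separating points. If $A$ is semisimple, elements of $A$ are identified with their Gelfand transforms, so that $A\subset\mathrm{cl}\,A\subset C(M_A)$. $\mathrm{Ch}(\mathrm{cl}\,A)\subset M_A$ is the Choquet boundary of $\mathrm{cl}\,A$. $T$ is not assumed to be linear or multiplicative. A real-algebra isomorphism is a bijective real-linear multiplicative map. *)

(* Defs.v *)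
From HB Require Import structures.
From mathcomp Require Import all_boot all_order all_algebra.
From mathcomp Require Import complex.
From mathcomp Require Import all_classical all_reals all_analysis.

Set Implicit Arguments.
Unset Strict Implicit.
Unset Printing Implicit Defensive.

Import Order.TTheory GRing.Theory Num.Theory.
Import numFieldNormedType.Exports.

Local Open Scope classical_set_scope.
Local Open Scope complex_scope.
Local Open Scope ring_scope.

(* A bare [R[i]] has no canonical topology; [R[i]^o] is the same field with its
   usual norm and topology. *)
Notation cplx R := (R[i]^o).

(* The modulus as an element of [R]: the norm [`|z|] itself lies in [R[i]]. *)
Definition cabs {R : realType} (z : cplx R) : R := complex.Re `|z|.

(* Commutative complex Banach algebras with a unit [1 != 0].  The normalization
   [`|1| = 1] is not imposed.  Joining [CompleteNormedModule] with the ring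
   structures is rejected by Hierarchy Builder, because [Num.NumDomain] already
   lies above both; hence the product is given by its own mixin, and the ring
   and algebra structures are derived from it below. *)
HB.mixin Record isComBanachAlgebra (R : realType) A
    & CompleteNormedModule R[i] A := {
  bone : A;
  bmul : A -> A -> A;
  bmulA : associative bmul;
  bmulC : commutative bmul;
  bmul1 : left_id bone bmul;
  bmulDl : left_distributive bmul +%R;
  bone_neq0 : bone != 0;
  bscaleAl : forall (z : R[i]) (x y : A), z *: bmul x y = bmul (z *: x) y;
  bnormM_le : forall x y : A, `|bmul x y| <= `|x| * `|y|
}.

#[short(type="comBanachAlgType")]
HB.structure Definition ComBanachAlgebra (R : realType) :=
  {A of CompleteNormedModule R[i] A & isComBanachAlgebra R A}.

#[non_forgetful_inheritance]
HB.instance Definition _ (R : realType) (A : comBanachAlgType R) :=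
  GRing.Zmodule_isComNzRing.Build A bmulA bmulC bmul1 bmulDl bone_neq0.
#[non_forgetful_inheritance]
HB.instance Definition _ (R : realType) (A : comBanachAlgType R) :=
  GRing.Lmodule_isLalgebra.Build R[i] A bscaleAl.
#[non_forgetful_inheritance]
HB.instance Definition _ (R : realType) (A : comBanachAlgType R) :=
  GRing.Lalgebra_isComAlgebra.Build R[i] A.

Section BanachAlgebra.
Context {R : realType} (A : comBanachAlgType R).

Definition invertible : set A := [set a | exists b, a * b = 1].

Definition spectrum (a : A) : set (cplx R) :=
  [set z | ~ invertible (z *: 1 - a)].

Definition spectral_radius (a : A) : R := sup (cabs @` spectrum a).

(* [idealr_closed] includes properness. *)
Definition maximal_ideal (I : {pred A}) : Prop :=
  idealr_closed I /\
  forall J : {pred A}, idealr_closed J -> {subset I <= J} -> J =i I.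

Definition semisimple : Prop :=
  forall a : A, (forall I : {pred A}, maximal_ideal I -> a \in I) -> a = 0.

(* The maximal ideal space is realized as the set of unital complex
   homomorphisms, with the topology of pointwise convergence on [A]. *)
Definition characters : set {ptws A -> cplx R} :=
  [set chi | linear (chi : A -> cplx R) /\
             monoid_morphism (chi : A -> cplx R)].

Definition max_ideal_space := set_type characters.
HB.instance Definition _ :=
  Topological.copy max_ideal_space (set_type characters).

Definition gelfand (a : A) : max_ideal_space -> cplx R :=
  fun chi => (set_val chi : A -> cplx R) a.

End BanachAlgebra.

Section FunctionSpaces.
Context {R : realType} {X : Type}.
Implicit Types (E : set (X -> cplx R)) (F G : X -> cplx R).

Definition supnorm F : R := sup (range (cabs \o F)).

(* The states of [E]: the linear functionals [L] on [E] with
   [L 1 = 1 = ||L||].  Only the values of [L] on [E] matter. *)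
Definition state E (L : (X -> cplx R) -> cplx R) : Prop :=
  [/\ forall (z : cplx R) F G, E F -> E G ->
        L (fun x => z * F x + G x) = z * L F + L G,
      L (fun=> 1) = 1
    & forall F, E F -> cabs (L F) <= supnorm F].

(* The points whose evaluation functional is an extreme point of the set of
   states of [E]. *)
Definition Choquet_boundary E : set X :=
  [set x | forall (L1 L2 : (X -> cplx R) -> cplx R) (t : R),
    state E L1 -> state E L2 -> 0 < t < 1 ->
    (forall F, E F -> F x = t%:C * L1 F + (1 - t)%:C * L2 F) ->
    forall F, E F -> L1 F = F x /\ L2 F = F x].

Definition fun_invertible E : set (X -> cplx R) :=
  [set F | E F /\ exists2 G, E G & forall x, F x * G x = 1].

End FunctionSpaces.

(* The closure of the Gelfand transform of [A] in [C(M_A)], for the supremum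
   norm. *)
Definition cl {R : realType} (A : comBanachAlgType R) :
    set (max_ideal_space A -> cplx R) :=
  [set F | continuous F /\
    forall e : R, 0 < e ->
      exists a : A, supnorm (fun x => F x - gelfand a x) < e].
Arguments cl {R} A _.

Definition homeomorphism (X Y : topologicalType) (f : X -> Y) : Prop :=
  continuous f /\
  exists g : Y -> X, [/\ continuous g, cancel f g & cancel g f].

Definition real_alg_iso_on {R : realType} {X Y : Type}
    (D : set (X -> cplx R)) (E : set (Y -> cplx R))
    (S : (X -> cplx R) -> (Y -> cplx R)) : Prop :=
  [/\ set_bij D E S,
      forall F G, D F -> D G ->
        S (fun x => F x + G x) = (fun y => S F y + S G y),
      forall (r : R) F, D F ->
        S (fun x => r%:C * F x) = (fun y => r%:C * S F y)
    & forall F G, D F -> D G ->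
        S (fun x => F x * G x) = (fun y => S F y * S G y)].

Definition real_alg_iso {R : realType} {A B : comBanachAlgType R}
    (S : A -> B) : Prop :=
  [/\ bijective S,
      forall a b, S (a + b) = S a + S b,
      forall (r : R) a, S (r%:C *: a) = r%:C *: S a
    & forall a b, S (a * b) = S a * S b].

(* Main.v *)
Require Import Defs.
From HB Require Import structures.
From mathcomp Require Import all_boot all_order all_algebra.
From mathcomp Require Import complex ring lra.
From mathcomp Require Import all_classical all_reals all_analysis.

Set Implicit Arguments.
Unset Strict Implicit.
Unset Printing Implicit Defensive.

Import Order.TTheory GRing.Theory Num.Theory.
Import numFieldNormedType.Exports.

Local Open Scope classical_set_scope.
Local Open Scope complex_scope.
Local Open Scope ring_scope.

(** Idea. Write [f(x)] for Gelfand transforms. After replacing [T] by [T1 T], the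
hypothesis gives [T(f^-1) = (Tf)^-1], [T(-1) = -1] and [T(i) = +-i] pointwise.
Given finitely many elements of [B], a point [y] at which the sum of their squared
moduli is nearly maximal is nearly exposed by a linear form, which yields [h] in [B]
with [Re h >= 1], [h(y) = 1] nearly, and [1/h] concentrated where these elements are
close to their values at [y]. If [TP = M/h] with [M] huge and [x] is a point
where [|P|] is nearly [M], then for [z] in [{1,-1,i,-i}] the solution [E] of
[TE = T(z) N/h] satisfies [E(x) = zN] nearly. Comparing [|f E - 1|] with
[|Tf TE - 1|], for [f] and for its inverse, and letting [N] grow shows that [Tf(y)] is nearly
[f(x)], or nearly its conjugate if [T(i)(y) = -i], for finitely many [f] at once.
Hence every real polynomial identity between invertible elements is preserved: [T] is
additive, multiplicative and real-homogeneous where defined, and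
[a |-> T(a + r) - r], with [r] large, is a real-algebra isomorphism [S] of [A] onto [B].
Dualizing [S] gives a homeomorphism of the maximal ideal spaces through which
[S] acts by composition, up to conjugation on a clopen set. A real-linear isometry
fixing [1] transports states through their real parts, so this homeomorphism
matches the Choquet boundaries. *)
(** * Gelfand theory *)

(** Two obstacles shape the central estimate. [B] is not uniformly closed, so peaks cannot be
    obtained as limits: [h] is an explicit affine combination of the given elements, invertible in
    [B] because [Re h >= 1]. And no map between points is known beforehand: [x] is selected by [P]
    alone, before [f] and [z], and since [1/h] cancels in [TP / TE], the modulus of every [E] is
    nearly maximal at this one [x]. The value [E(x)] is then forced, because [E / z] ranges in the
    disc [|w - 1| <= N - 1], which has a single point of modulus [N]. In the expansion
    [|N w - 1| = N |w| - Re w / |w| + O(1/N)] the leading term compares moduli and the next one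
    compares directions; this is why [N] grows and why four values of [z] are used. Inverses supply
    the reverse comparison of moduli. The pair of points depends on the finite family and on the
    precision, so a genuine point map appears only after algebraic identities have produced [S]. *)

Section Modulus.
Context {R : realType}.
Implicit Types (z w : cplx R) (r : R).

Lemma normE_cabs z : `|z| = (cabs z)%:C.
Proof. by rewrite /cabs normc_def. Qed.

Lemma sqr_cabs z : cabs z ^+ 2 = complex.Re z ^+ 2 + complex.Im z ^+ 2.
Proof. by rewrite /cabs normc_def /= sqr_sqrtr// addr_ge0 ?sqr_ge0. Qed.

Lemma cabs_ge0 z : 0 <= cabs z.
Proof. by rewrite /cabs normc_def /= sqrtr_ge0. Qed.

Lemma cabsM z w : cabs (z * w) = cabs z * cabs w.
Proof. by apply: complexI; rewrite rmorphM /= -!normE_cabs normrM. Qed.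

Lemma cabsD z w : cabs (z + w) <= cabs z + cabs w.
Proof. by rewrite -lecR rmorphD /= -!normE_cabs; exact: ler_normD. Qed.

Lemma cabsN z : cabs (- z) = cabs z.
Proof. by rewrite /cabs normrN. Qed.

Lemma cabsC z w : cabs (z - w) = cabs (w - z).
Proof. by rewrite -cabsN opprB. Qed.

Lemma cabsB z w : cabs (z - w) <= cabs z + cabs w.
Proof. by rewrite -(cabsN w); exact: cabsD. Qed.

Lemma cabs_real r : cabs (r%:C : cplx R) = `|r|.
Proof. by rewrite /cabs normc_def /= expr0n addr0 sqrtr_sqr. Qed.

Lemma cabs0 : cabs (0 : cplx R) = 0.
Proof. by rewrite /cabs normr0. Qed.

Lemma cabs1 : cabs (1 : cplx R) = 1.
Proof. by rewrite /cabs normr1. Qed.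

Lemma cabs_eq0 z : cabs z = 0 -> z = 0.
Proof. by move=> h; apply/eqP; rewrite -normr_eq0 normE_cabs h. Qed.

Lemma cabs_gt0 z : z != 0 -> 0 < cabs z.
Proof.
move=> z0; rewrite lt_neqAle cabs_ge0 andbT eq_sym; apply/eqP => /cabs_eq0 h.
by rewrite h eqxx in z0.
Qed.

Lemma cabsV z : cabs (z^-1) = (cabs z)^-1.
Proof. by apply: complexI; rewrite fmorphV /= -!normE_cabs normfV. Qed.

Lemma cabsX z n : cabs (z ^+ n) = cabs z ^+ n.
Proof. by elim: n => [|n ih]; rewrite ?expr0 ?cabs1// !exprS cabsM ih. Qed.

Lemma cabs_conj z : cabs (z^* : cplx R) = cabs z.
Proof. by rewrite /cabs normcJ. Qed.

Lemma Re_le_cabs z : complex.Re z <= cabs z.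
Proof.
apply: le_trans (ler_norm _) _; rewrite -lecR -normE_cabs; exact: normc_ge_Re.
Qed.

Lemma cabs_i : cabs ('i%C : cplx R) = 1.
Proof. by rewrite /cabs normc_def /= expr0n add0r expr1n sqrtr1. Qed.

Lemma cabs_le r z : 0 <= r -> complex.Re z ^+ 2 + complex.Im z ^+ 2 <= r ^+ 2 ->
  cabs z <= r.
Proof. by move=> r0; rewrite -sqr_cabs ler_sqr// nnegrE ?cabs_ge0. Qed.

Lemma le_cabs r z : 0 <= r -> cabs z <= r ->
  complex.Re z ^+ 2 + complex.Im z ^+ 2 <= r ^+ 2.
Proof. by move=> r0; rewrite -sqr_cabs ler_sqr// nnegrE ?cabs_ge0. Qed.

End Modulus.

Section BanachNorm.
Context {R : realType} {A : comBanachAlgType R}.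
Implicit Types (a b : A) (z : R[i]).

Definition nrm a : R := complex.Re `|a|.

Lemma normE_nrm a : `|a| = (nrm a)%:C.
Proof. by rewrite /nrm RRe_real //; apply: ger0_real; apply: normr_ge0. Qed.

Lemma nrm_ge0 a : 0 <= nrm a.
Proof. by rewrite -lecR -normE_nrm rmorph0; exact: normr_ge0. Qed.

Lemma nrmD a b : nrm (a + b) <= nrm a + nrm b.
Proof. by rewrite -lecR rmorphD /= -!normE_nrm; exact: ler_normD. Qed.

Lemma nrmN a : nrm (- a) = nrm a.
Proof. by rewrite /nrm normrN. Qed.

Lemma nrmM a b : nrm (a * b) <= nrm a * nrm b.
Proof. by rewrite -lecR rmorphM /= -!normE_nrm; exact: bnormM_le. Qed.

Lemma nrmZ z a : nrm (z *: a) = cabs z * nrm a.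
Proof.
by apply: complexI; rewrite rmorphM /= -!normE_nrm normrZ -normE_cabs.
Qed.

Lemma nrm0 : nrm 0 = 0.
Proof. by rewrite /nrm normr0. Qed.

Lemma nrm_eq0 a : nrm a = 0 -> a = 0.
Proof. by move=> h; apply/eqP; rewrite -normr_eq0 normE_nrm h. Qed.

Lemma nrmX_le a n : nrm (a ^+ n.+1) <= nrm a ^+ n.+1.
Proof.
elim: n => [|n ih]; first by rewrite !expr1.
rewrite exprS [leRHS]exprS; apply: le_trans (nrmM _ _) _.
by rewrite ler_wpM2l ?nrm_ge0.
Qed.

Lemma expr_small (c e : R) : 0 <= c -> c < 1 -> 0 < e -> exists N, c ^+ N < e.
Proof.
move=> c0 c1 e0; have /cvgrPdist_lt/(_ _ e0) : (fun n => c ^+ n) @ \oo --> (0 : R).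
  by apply: cvg_expr; rewrite ger0_norm.
move=> [N _ /(_ N (leqnn N))] /=; rewrite sub0r normrN ger0_norm ?exprn_ge0// => h.
by exists N.
Qed.

(* Neumann series *)
Lemma one_sub_invertible a : nrm a < 1 -> invertible (1 - a).
Proof.
(* [s n] is the sum of the powers [a ^+ k] with [k < n], in Horner form. *)
move=> a1; pose s n := iter n (fun x => 1 + a * x) (0 : A).
have sS n : s n.+1 = 1 + a * s n by [].
have sD N m : s (N + m)%N - s N = a ^+ N * s m.
  elim: N => [|N ih]; first by rewrite add0n /= subr0 expr0 mul1r.
  by rewrite addSn !sS exprS -mulrA -ih; ring.
pose K := nrm 1 / (1 - nrm a).
have d0 : 0 < 1 - nrm a by rewrite subr_gt0.
have K0 : 0 <= K by rewrite divr_ge0 ?nrm_ge0// ltW.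
have sK m : nrm (s m) <= K.
  elim: m => [|m ih]; first by rewrite nrm0.
  rewrite sS; apply: le_trans (nrmD _ _) _.
  have := nrmM a (s m); have := ler_wpM2l (nrm_ge0 a) ih.
  have -> : nrm 1 = K * (1 - nrm a) by rewrite /K divfK// gt_eqF.
  lra.
have small (e : R) : 0 < e -> exists N, forall m, nrm (s (N + m)%N - s N) < e.
  move=> e0; have [N hN] := expr_small (nrm_ge0 a) a1 (divr_gt0 e0 (ltr_wpDl K0 ltr01)).
  (* The exponent is shifted by one because [nrm 1] may exceed [1]: powers are controlled by
     [nrmX_le] for positive exponents only. *)
  exists N.+1 => m; rewrite sD; apply: le_lt_trans (nrmM _ _) _.
  have aN : nrm (a ^+ N.+1) <= nrm a ^+ N.
    apply: le_trans (nrmX_le _ _) _; rewrite exprS ler_piMl ?exprn_ge0 ?nrm_ge0//.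
    exact: ltW.
  move: hN; rewrite ltr_pdivlMr ?ltr_wpDl// => hN; apply: le_lt_trans hN.
  by rewrite ler_pM ?nrm_ge0//; apply: le_trans (sK m) _; rewrite lerDl.
have /cvg_ex[b sb] : cvg (s @ \oo).
  apply: cauchy_cvg; apply: cauchy_exP => e e0.
  have e0' : 0 < complex.Re e by move: e0; rewrite ltcE => /andP[].
  have eE : e = (complex.Re e)%:C by rewrite RRe_real// gtr0_real.
  have [N hN] := small _ e0'; exists (s N); exists N => // n /= Nn.
  rewrite -ball_normE /= distrC -(subnKC Nn) normE_nrm eE ltcR; exact: hN.
exists b; apply/eqP; rewrite -subr_eq0; apply/eqP/nrm_eq0/eqP.
rewrite eq_le nrm_ge0 andbT; apply/ler_addgt0Pl => e e0; rewrite addr0.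
have : 0 < (e / 2)%:C :> R[i] by rewrite ltcR divr_gt0.
move/cvgrPdist_lt : sb => /[apply] -[N _ hN].
have := hN N (leqnn N); have := hN N.+1 (leqnSn N) => /=.
rewrite !normE_nrm !ltcR => h1 h2.
have -> : (1 - a) * b - 1 = (b - s N.+1) + - (a * (b - s N)) by rewrite sS; ring.
apply: le_trans (nrmD _ _) _; rewrite nrmN; have := nrmM a (b - s N).
have : nrm a * nrm (b - s N) <= nrm (b - s N).
  by rewrite ler_piMl ?nrm_ge0// ltW.
lra.
Qed.

End BanachNorm.
Section PlaneTopology.
Context {R : realType}.

Lemma real_complex_continuous : continuous (real_complex R : R -> cplx R).
Proof.
move=> x; apply/cvgrPdist_lt => e e0.
have e0' : 0 < complex.Re e by move: e0; rewrite ltcE => /andP[].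
have eE : e = (complex.Re e)%:C by rewrite RRe_real// gtr0_real.
have /cvgrPdist_lt/(_ _ e0') : (fun y : R => y) @ x --> x by exact: cvg_id.
apply: filterS => y /= h.
by rewrite -rmorphB /= (@normE_cabs R) cabs_real eE ltcR.
Qed.

Lemma cabs_continuous : continuous (@cabs R).
Proof.
move=> x; apply/(@cvgrPdist_lt _ _ _ _ (nbhs_filter x)) => e e0.
have e0' : 0 < e%:C :> R[i] by rewrite ltcR.
have h : nbhs x (ball x e%:C) by exact: nbhsx_ballx.
apply: (@filterS _ _ (nbhs_filter x) _ _ _ h) => y;
rewrite -ball_normE /= (@normE_cabs R) ltcR; apply: le_lt_trans.
rewrite ler_norml lerBrDl -lerBDr opprK lerBlDr.
have := cabsD (x - y) y; have := cabsD (y - x) x.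
by rewrite !subrK (cabsC y) => h1 h2; apply/andP; split; lra.
Qed.

Lemma compact_disc (r : R) : compact [set z : cplx R | cabs z <= r].
Proof.
pose g (p : R * R) : cplx R := p.1%:C + 'i%C * p.2%:C.
have gc : continuous g.
  move=> p; apply: cvgD.
    by apply: continuous_comp; [exact: cvg_fst|exact: real_complex_continuous].
  apply: cvgM; first exact: cvg_cst.
  by apply: continuous_comp; [exact: cvg_snd|exact: real_complex_continuous].
apply: (@subclosed_compact _ _ (g @` (`[-r, r] `*` `[-r, r]))).
- have -> : [set z : cplx R | cabs z <= r] = cabs @^-1` [set x | x <= r] by [].
  by apply: preimage_closed; [move=> ? _; exact: cabs_continuous|exact: closed_le].
- apply: continuous_compact; first exact: continuous_subspaceT.
  by apply: compact_setX; exact: segment_compact.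
move=> z /= zr; exists (complex.Re z, complex.Im z); last first.
  by rewrite /g /= -complexE.
have r0 : 0 <= r by apply: le_trans zr; exact: cabs_ge0.
have := le_cabs r0 zr; set x := complex.Re z; set y := complex.Im z => h.
by split; rewrite /= in_itv /=; apply/andP; split; nra.
Qed.

End PlaneTopology.

(** * Maximal ideals and the quotient seminorm *)

Section Ideals.
Context {R : realType} {A : comBanachAlgType R}.
Implicit Types (I J : set A) (a b c x y : A) (z w : R[i]).

(** Proper ideals as classical sets, the form in which Zorn's lemma applies; [semisimpleP] makes the
    link with the boolean predicates of [maximal_ideal]. *)
Definition is_ideal I : Prop :=
  [/\ I 0, forall x y, I x -> I y -> I (x + y),
      forall x y, I y -> I (x * y) & ~ I 1].

Definition is_maximal I : Prop :=
  is_ideal I /\ forall J, is_ideal J -> I `<=` J -> J `<=` I.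

Lemma exists_maximal I : is_ideal I -> exists2 M, is_maximal M & I `<=` M.
Proof.
(* Zorn's lemma is applied to sets whose union with [I] is a proper ideal: the empty chain then
   causes no trouble and the ideal obtained contains [I]. *)
move=> [I0 ID IM I1]; pose P J := is_ideal (I `|` J).
have [F FP Ftot|M [MP Mmax]] := @Zorn_bigcup A P.
  have [F0|/set0P[X0 FX0]] := eqVneq F set0.
    by rewrite F0 bigcup_set0 /P setU0.
  have memP x : (I `|` \bigcup_(X in F) X) x -> exists2 X, F X & (I `|` X) x.
    by move=> [Ix|[X FX Xx]]; [exists X0 => //; left|exists X => //; right].
  split.
  - by left.
  - move=> x y /memP[X FX Xx] /memP[Y FY Yy].
    have [XY|YX] := Ftot _ _ FX FY.
      have [_ D _ _] := FP _ FY; have [|h|h] := D x y _ Yy; [|by left|].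
        by case: Xx => [Ix|/XY h]; [left|right].
      by right; exists Y.
    have [_ D _ _] := FP _ FX; have [|h|h] := D x y Xx _; [|by left|].
      by case: Yy => [Iy|/YX h]; [left|right].
    by right; exists X.
  - move=> x y /memP[X FX Xy].
    by have [_ _ D _] := FP _ FX; have [h|h] := D x y Xy; [left|right; exists X].
  - by move=> /memP[X FX X1]; have [_ _ _] := FP _ FX; apply.
exists (I `|` M); last by move=> x; left.
split=> // J JI sub x Jx; right; apply: contrapT => Mx; apply: (Mmax J); last first.
  by rewrite /P setUidr// => y Iy; apply: sub; left.
split; last by move=> /(_ x Jx).
by move=> y My; apply: sub; right.
Qed.

Lemma ideal_sub I x y : is_ideal I -> I x -> I y -> I (x - y).
Proof.
by move=> [_ ID IM _] Ix Iy; apply: ID => //; rewrite -mulN1r; exact: IM.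
Qed.

(** Otherwise [a A + I] would be a proper ideal containing both [I] and [a]. *)
Lemma maximal_inverse I a : is_maximal I -> ~ I a -> exists b, I (a * b - 1).
Proof.
move=> [Iid Imax] Ia; have [I0 ID IM I1] := Iid.
apply: contrapT => /forallNP nb; apply: Ia.
apply: (Imax [set x | exists c y, I y /\ x = a * c + y]).
- split.
  + by exists 0, 0; rewrite mulr0 addr0.
  + move=> _ _ [c [y [Iy ->]]] [c' [y' [Iy' ->]]].
    by exists (c + c'), (y + y'); split; [exact: ID|ring].
  + move=> x _ [c [y [Iy ->]]].
    by exists (x * c), (x * y); split; [exact: IM|ring].
  + move=> [c [y [Iy e]]]; apply: (nb c).
    have -> : a * c - 1 = (-1) * y by rewrite -[y](addKr (a * c)) -e; ring.
    exact: IM.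
- by move=> x Ix; exists 0, x; rewrite mulr0 add0r.
- by exists 1, 0; rewrite mulr1 addr0.
Qed.

End Ideals.

Section QuotientNorm.
Context {R : realType} {A : comBanachAlgType R} (I : set A).
Hypothesis Iid : is_ideal I.
Implicit Types (a b c x y : A) (z w : R[i]).

(** The quotient seminorm of [A / I] read on representatives; congruences modulo [I] replace
    computations in the quotient algebra. *)
Definition qnorm x : R := inf [set nrm (x + c) | c in I].

Let has_inf_q x : has_inf [set nrm (x + c) | c in I].
Proof.
split; first by exists (nrm (x + 0)); exists 0 => //; case: Iid.
by exists 0 => _ [c _ <-]; exact: nrm_ge0.
Qed.

Lemma qnorm_le x c : I c -> qnorm x <= nrm (x + c).
Proof. by move=> Ic; apply: ge_inf; [case: (has_inf_q x)|exists c]. Qed.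

Lemma qnorm_adherent x (e : R) : 0 < e ->
  exists2 c, I c & nrm (x + c) < qnorm x + e.
Proof.
by move=> e0; have [_ [c Ic <-] h] := inf_adherent e0 (has_inf_q x); exists c.
Qed.

Lemma qnorm_ge0 x : 0 <= qnorm x.
Proof.
by apply: lb_le_inf; [case: (has_inf_q x)|move=> _ [c _ <-]; exact: nrm_ge0].
Qed.

Lemma qnorm_le_nrm x : qnorm x <= nrm x.
Proof. by rewrite -{2}(addr0 x); apply: qnorm_le; case: Iid. Qed.

Lemma qnormD x y : qnorm (x + y) <= qnorm x + qnorm y.
Proof.
apply/ler_addgt0Pl => e e0; have e2 : 0 < e / 2 by rewrite divr_gt0.
have [c Ic hc] := qnorm_adherent x e2; have [d Id hd] := qnorm_adherent y e2.
have Icd : I (c + d) by case: Iid => _ D _ _; exact: D.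
apply: le_trans (qnorm_le (x + y) Icd) _; rewrite addrACA.
by apply: le_trans (nrmD _ _) _; lra.
Qed.

Lemma qnormM x y : qnorm (x * y) <= qnorm x * qnorm y.
Proof.
apply/ler_addgt0Pl => e e0.
have qx := qnorm_ge0 x; have qy := qnorm_ge0 y.
(* For [d <= 1], [(qnorm x + d) * (qnorm y + d)] exceeds [qnorm x * qnorm y] by at most [d * s]. *)
pose s := qnorm x + qnorm y + 1; have s0 : 0 < s by rewrite /s; lra.
pose d := Num.min 1 (e / s).
have d0 : 0 < d by rewrite /d lt_min ltr01 divr_gt0.
have d1 : d <= 1 by rewrite /d ge_min lexx.
have ds : d * s <= e by rewrite -ler_pdivlMr// /d ge_min lexx orbT.
have [c Ic hc] := qnorm_adherent x d0; have [c' Ic' hc'] := qnorm_adherent y d0.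
have [I0 ID IM _] := Iid.
have Ik : I (x * c' + y * c + c * c') by exact: (ID _ _ (ID _ _ (IM _ _ Ic') (IM _ _ Ic)) (IM _ _ Ic')).
apply: le_trans (qnorm_le (x * y) Ik) _.
have -> : x * y + (x * c' + y * c + c * c') = (x + c) * (y + c') by ring.
apply: le_trans (nrmM _ _) _.
apply: (@le_trans _ _ ((qnorm x + d) * (qnorm y + d))).
  by rewrite ler_pM// ?nrm_ge0// ltW.
rewrite /s in ds; nra.
Qed.

Lemma qnorm_add_ideal x c : I c -> qnorm (x + c) = qnorm x.
Proof.
move=> Ic; have [I0 ID IM _] := Iid.
have q0 y : I y -> qnorm y = 0.
  move=> Iy; apply/eqP; rewrite eq_le qnorm_ge0 andbT -(@nrm0 R A).
  rewrite -(subrr y); apply: qnorm_le; rewrite -mulN1r; exact: IM.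
have INc : I (- c) by rewrite -mulN1r; exact: IM.
have h1 := qnormD x c; have h2 := qnormD (x + c) (- c); rewrite addrK in h2.
by rewrite (q0 c)// addr0 in h1; rewrite (q0 (- c))// addr0 in h2; apply/eqP; rewrite eq_le h1.
Qed.

(** If [nrm (1 + c) < 1] with [c] in [I], the Neumann series inverts [- c], an element of a proper
    ideal. *)
Lemma qnorm1_ge1 : 1 <= qnorm 1.
Proof.
apply: lb_le_inf; first by case: (has_inf_q 1).
move=> _ [c Ic <-]; rewrite leNgt; apply/negP => /one_sub_invertible[b].
rewrite opprD addrA subrr add0r => h; have [_ _ IM I1] := Iid; apply: I1.
by rewrite -h mulNr -mulrN mulrC; exact: IM.
Qed.

Lemma qnormZ z x : qnorm (z *: x) <= cabs z * qnorm x.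
Proof.
have [->|z0] := eqVneq z 0.
  by rewrite cabs0 mul0r scale0r; apply: le_trans (qnorm_le_nrm _) _; rewrite nrm0.
rewrite -ler_pdivrMl ?cabs_gt0//.
apply: lb_le_inf; first by case: (has_inf_q x).
move=> _ [c Ic <-]; rewrite ler_pdivrMl ?cabs_gt0// -nrmZ scalerDr.
apply: qnorm_le; rewrite -(mul1r c) scalerAl.
by case: Iid => _ _ IM _; exact: IM.
Qed.

End QuotientNorm.

(** * The Gelfand-Mazur theorem by a maximum principle *)

Section GelfandMazur.
Context {R : realType} {A : comBanachAlgType R} (I : set A).
Hypothesis Iid : is_ideal I.
Variables (a : A) (b : cplx R -> A).
Hypothesis bP : forall z, I ((a - z%:A) * b z - 1).
Local Notation f z := (qnorm I (b z)).

Lemma resolvent_identity z w : I (b w - b z - (w - z)%:A * (b z * b w)).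
Proof.
have -> : b w - b z - (w - z)%:A * (b z * b w) =
    b z * ((a - w%:A) * b w - 1) - b w * ((a - z%:A) * b z - 1).
  by rewrite scalerBl; ring.
by have [_ _ IM _] := Iid; apply: ideal_sub => //; exact: IM.
Qed.

Lemma qnorm_congr x y : I (x - y) -> qnorm I x = qnorm I y.
Proof. by move=> h; rewrite -(subrK y x) addrC qnorm_add_ideal. Qed.

Lemma qnormZA z x : qnorm I (z%:A * x) <= cabs z * qnorm I x.
Proof. by rewrite -scalerAl mul1r qnormZ. Qed.

Lemma resolvent_gt0 z : 0 < f z.
Proof.
have h : 1 <= qnorm I (a - z%:A) * f z.
  by apply: le_trans (qnorm1_ge1 Iid) _; rewrite -(qnorm_congr (bP z)) qnormM.
have := qnorm_ge0 Iid (b z); have := qnorm_ge0 Iid (a - z%:A); nra.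
Qed.

Lemma resolvent_lip z w : `|f w - f z| <= cabs (w - z) * f z * f w.
Proof.
have key z' w' : f w' <= f z' + cabs (w' - z') * (f z' * f w').
  have h : I (b w' - (b z' + (w' - z')%:A * (b z' * b w'))).
    by rewrite opprD addrA; exact: resolvent_identity.
  rewrite {1}(qnorm_congr h); apply: le_trans (qnormD Iid _ _) _; rewrite lerD2l.
  apply: le_trans (qnormZA _ _) _; rewrite ler_wpM2l ?cabs_ge0//; exact: qnormM.
have h1 := key z w; have h2 := key w z; rewrite (cabsC z w) in h2.
by rewrite ler_norml; apply/andP; split; lra.
Qed.

Lemma resolvent_continuous : continuous (fun z => f z).
Proof.
move=> z; apply/(@cvgrPdist_lt _ _ _ _ (nbhs_filter z)) => e e0.
have fz := resolvent_gt0 z.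
(* The first bound gives [f w <= 2 * f z] through [resolvent_lip]; the second then makes the
   right-hand side of [resolvent_lip] less than [e]. *)
pose d := Num.min ((2 * f z)^-1) (e / (2 * (f z) ^+ 2)).
have d0 : 0 < d.
  by rewrite /d lt_min invr_gt0 divr_gt0// ?mulr_gt0// ?exprn_gt0.
have d0' : 0 < d%:C :> R[i] by rewrite ltcR.
have h : nbhs z (ball z d%:C) by exact: nbhsx_ballx.
apply: (@filterS _ _ (nbhs_filter z) _ _ _ h) => w.
rewrite -ball_normE /= (@normE_cabs R) ltcR cabsC lt_min => /andP[].
rewrite -[X in _ < X]div1r !ltr_pdivlMr ?mulr_gt0// ?exprn_gt0// => h1 h2.
have := resolvent_lip z w; rewrite distrC; have := cabs_ge0 (w - z).
have := resolvent_gt0 w; set t := cabs (w - z) in h1 h2 *.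
move: (f z) (f w) fz h1 h2 {h d0 d0' d} => u v u0 h1 h2 v0 t0 h3.
have v2 : v <= 2 * u.
  have : v - u <= t * u * v by apply: le_trans h3; rewrite distrC ler_norm.
  nra.
apply: le_lt_trans h3 _; nra.
Qed.

(** Modulo [I], [b (z + w)] has a Taylor expansion of order four whose remainder is
    [w ^+ 4 * b z ^+ 4 * b (z + w)]. Summing over the four values [w = i^k e] cancels the powers
    [w], [w ^+ 2] and [w ^+ 3], while [w ^+ 4 = e ^+ 4] throughout, so the sum [s] satisfies
    [4 * b z = s * (1 - e ^+ 4 * b z ^+ 4)] modulo [I]. *)
Lemma resolvent_average (z : cplx R) (e : R) :
  4 * f z <= (f (z + e%:C) + f (z - e%:C) + f (z + e%:C * 'i%C) +
    f (z - e%:C * 'i%C)) * (1 + e ^+ 4 * f z ^+ 4).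
Proof.
have [I0 ID IM I1] := Iid.
have four w : I (b (z + w) - (b z + w%:A * b z ^+ 2 + w%:A ^+ 2 * b z ^+ 3 +
    w%:A ^+ 3 * b z ^+ 4 + w%:A ^+ 4 * b z ^+ 4 * b (z + w))).
  have := resolvent_identity z (z + w); rewrite (addrC z) addrK.
  set W := w%:A; set u := b z; set v := b (w + z) => h.
  (* This multiplier telescopes: [(1 - W * u)] times it is [1 - W ^+ 4 * u ^+ 4]. *)
  have := IM (1 + W * u + W ^+ 2 * u ^+ 2 + W ^+ 3 * u ^+ 3) _ h.
  by congr I; ring.
pose E : A := (e%:C)%:A; pose J : A := 'i%C%:A.
have J2 : J * J = -1.
  by rewrite /J -scalerAl mul1r scalerA -expr2 sqr_i scaleN1r.
have EJ : (e%:C * 'i%C)%:A = E * J by rewrite /E /J -scalerAl mul1r scalerA.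
have := four e%:C; have := four (- e%:C); have := four (e%:C * 'i%C).
have := four (- (e%:C * 'i%C)); rewrite !scaleNr EJ -/E.
set u := b z; set v1 := b _; set v2 := b (z + _ * _).
set v3 := b (z - _); set v4 := b _ => h1 h2 h3 h4.
pose s := v4 + v3 + v2 + v1.
have hs : I (s * (1 - E ^+ 4 * u ^+ 4) - 4%:R * u).
  have := ID _ _ (ID _ _ (ID _ _ h4 h3) h2) h1.
  by congr I; rewrite /s; ring: J2.
have sle : qnorm I s <= f (z + e%:C) + f (z - e%:C) + f (z + e%:C * 'i%C) +
    f (z - e%:C * 'i%C).
  rewrite /s; apply: le_trans (qnormD Iid _ _) _; rewrite lerD2r.
  by apply: le_trans (qnormD Iid _ _) _; rewrite lerD2r; exact: qnormD.
apply: (@le_trans _ _ (qnorm I s * (1 + e ^+ 4 * f z ^+ 4))); last first.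
  by rewrite ler_wpM2r// addr_ge0// mulr_ge0// ?exprn_even_ge0.
have fu : qnorm I (u ^+ 4) <= f z ^+ 4.
  rewrite !exprS !expr0 !mulr1.
  do 3![apply: le_trans (qnormM Iid _ _) _; rewrite ler_pM ?qnorm_ge0//].
have f4 : 4 * f z <= qnorm I (4%:R * u).
  have -> : b z = (4^-1)%:C *: (4%:R * u).
    have -> : 4%:R * u = (4%:R : R)%:C *: u.
      by rewrite rmorph_nat scaler_nat mulr_natl.
    by rewrite scalerA -rmorphM mulVf ?pnatr_eq0// scale1r.
  have := qnormZ Iid (4^-1)%:C (4%:R * u); rewrite cabs_real ger0_norm ?invr_ge0//.
  lra.
apply: le_trans f4 _; rewrite -(qnorm_congr hs).
have -> : s * (1 - E ^+ 4 * u ^+ 4) = s + ((- e%:C ^+ 4)%:A) * (s * u ^+ 4).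
  have -> : (- e%:C ^+ 4)%:A = - E ^+ 4 by rewrite /E exprZn expr1n scaleNr.
  ring.
rewrite mulrDr mulr1; apply: le_trans (qnormD Iid _ _) _; rewrite lerD2l.
apply: le_trans (qnormZA _ _) _.
rewrite cabsN cabsX cabs_real -normrX ger0_norm ?exprn_even_ge0//.
rewrite [leRHS]mulrCA; apply: ler_wpM2l; first exact: exprn_even_ge0.
by apply: le_trans (qnormM Iid _ _) _; apply: ler_wpM2l; rewrite ?qnorm_ge0.
Qed.

(* The maximum principle for [z |-> q ((a - z)^-1)], strengthened by a small
   multiple of [|z|^2]: averaging over the four points [z + i^k e] is exact up
   to [O(e^4)], while the average of [|z|^2] increases by [e^2]. *)
Lemma no_resolvent : False.
Proof.
have f0 := resolvent_gt0 0.
have [q1 n0] : 0 <= qnorm I 1 /\ 0 <= nrm a by rewrite qnorm_ge0// nrm_ge0.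
(* Since [z b z = a b z - 1] modulo [I], [(|z| - nrm a) * f z <= qnorm I 1]; the radius [r] makes
   this yield [f z <= f 0 / 2] on the circle [|z| = r]. *)
pose r := nrm a + 2 * qnorm I 1 / f 0 + 1.
have r0 : 0 < r by rewrite /r ltr_wpDl// addr_ge0// divr_ge0// ?mulr_ge0// ltW.
have decay z : cabs z = r -> f z <= f 0 / 2.
  move=> zr.
  have h : cabs z * f z <= nrm a * f z + qnorm I 1.
    have -> : cabs z * f z = qnorm I (z%:A * b z).
      apply/eqP; rewrite eq_le qnormZA andbT.
      have z0 : z != 0 by apply/eqP => e; move: zr r0; rewrite e cabs0 => <-; rewrite ltxx.
      rewrite -ler_pdivlMl ?cabs_gt0// -cabsV.
      by have := qnormZ Iid z^-1 (z%:A * b z); rewrite -scalerAl mul1r scalerA mulVf// scale1r.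
    have h : I (z%:A * b z - (a * b z - 1)).
      have -> : z%:A * b z - (a * b z - 1) = (-1) * ((a - z%:A) * b z - 1) by ring.
      by case: Iid => _ _ IM _; exact: IM.
    rewrite (qnorm_congr h); apply: le_trans (qnormD Iid _ _) _.
    have -> : qnorm I (-1) = qnorm I 1.
      apply/eqP; rewrite eq_le; apply/andP; split.
        by have := qnormZ Iid (-1) (1 : A); rewrite cabsN cabs1 mul1r scaleN1r.
      by have := qnormZ Iid (-1) (-1 : A); rewrite cabsN cabs1 mul1r scaleN1r opprK.
    rewrite lerD2r; apply: le_trans (qnormM Iid _ _) _.
    by rewrite ler_wpM2r ?qnorm_ge0// qnorm_le_nrm.
  have := resolvent_gt0 z; rewrite zr /r in h => fz.
  have h' : (2 * qnorm I 1 / f 0) * f z <= qnorm I 1 by nra.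
  have : 2 * qnorm I 1 * f z <= qnorm I 1 * f 0.
    by rewrite -ler_pdivrMr// mulrAC.
  have := qnorm1_ge1 Iid; nra.
(* With this weight the perturbed function is at most [3/4 * f 0] on the circle [|z| = r] and equals
   [f 0] at the centre, so its maximum over the disc lies inside. *)
pose c := f 0 / (4 * r ^+ 2).
have c0 : 0 < c by rewrite divr_gt0// mulr_gt0// exprn_gt0.
have cr : c * r ^+ 2 = f 0 / 4 by rewrite /c; field; rewrite gt_eqF.
pose h (z : cplx R) := f z + c * cabs z ^+ 2.
have hc : continuous h.
  move=> z; have FF := nbhs_filter z.
  have cc := @cabs_continuous R z.
  apply: cvgD; first exact: (@resolvent_continuous z).
  have c2 : continuous_at z (fun x : cplx R => cabs x * cabs x).
    exact: (@cvgM _ _ _ FF _ _ _ _ cc cc).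
  exact: (@cvgM _ _ _ FF _ _ _ _ (@cvg_cst _ _ _ _ FF) c2).
have [|z0 z0r zmax] := compact_EVT_max _ (@compact_disc R r) (continuous_subspaceT hc).
  by exists 0; rewrite /= cabs0 ltW.
have {}zmax z : cabs z <= r -> h z <= h z0 by move=> zr; apply: zmax; rewrite inE.
rewrite inE /= in z0r.
have z0lt : cabs z0 < r.
  rewrite lt_neqAle z0r andbT; apply/eqP => e.
  have := zmax 0; rewrite cabs0 => /(_ (ltW r0)).
  by rewrite /h cabs0 e expr0n mulr0 addr0; have := decay _ e; lra.
set F := f z0; have F0 : 0 < F := resolvent_gt0 z0.
(* The four points must stay in the disc, [e <= 1] gives [e ^+ 2 <= e], and the last bound
   contradicts the inequality [c <= F ^+ 5 * e ^+ 2] that the averaging produces. *)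
pose e := Num.min (r - cabs z0) (Num.min 1 (c / (2 * F ^+ 5))).
have e0 : 0 < e.
  by rewrite /e !lt_min subr_gt0 z0lt ltr01 divr_gt0// mulr_gt0// exprn_gt0.
have er : e <= r - cabs z0 by rewrite /e ge_min lexx.
have e1 : e <= 1 by rewrite /e !ge_min lexx !orbT.
have eF : e * (2 * F ^+ 5) <= c.
  by rewrite -ler_pdivlMr ?mulr_gt0 ?exprn_gt0// /e !ge_min lexx !orbT.
have ce : cabs (e%:C : cplx R) = e by rewrite cabs_real ger0_norm// ltW.
have inD w : cabs w = e -> h (z0 + w) <= h z0.
  by move=> we; apply: zmax; apply: le_trans (cabsD _ _) _; rewrite we; lra.
have h1 := inD e%:C ce.
have h2 := inD (- e%:C); rewrite cabsN in h2; have {}h2 := h2 ce.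
have ce' : cabs (e%:C * 'i%C : cplx R) = e by rewrite cabsM cabs_i mulr1.
have h3 := inD _ ce'.
have h4 := inD (- (e%:C * 'i%C)); rewrite cabsN in h4; have {}h4 := h4 ce'.
have avg := resolvent_average z0 e; rewrite -/F in avg.
have sq : cabs (z0 + e%:C) ^+ 2 + cabs (z0 - e%:C) ^+ 2 +
    cabs (z0 + e%:C * 'i%C) ^+ 2 + cabs (z0 - e%:C * 'i%C) ^+ 2 =
    4 * cabs z0 ^+ 2 + 4 * e ^+ 2.
  by rewrite !sqr_cabs; case: (z0) => x y /=; ring.
rewrite /h -/F in h1 h2 h3 h4.
move: avg; set s := f (z0 + _) + _ + _ + _ => avg.
have sF : s <= 4 * F - 4 * c * e ^+ 2.
  by rewrite /s; have := congr1 (fun x => c * x) sq; rewrite !mulrDr; lra.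
have F4 : 0 < F ^+ 4 by rewrite exprn_gt0.
have F5 : F ^+ 5 = F * F ^+ 4 by rewrite exprS.
have e2 : 0 < e ^+ 2 by rewrite exprn_gt0.
have e4 : e ^+ 4 = e ^+ 2 * e ^+ 2 by rewrite -exprD.
have e3 : e ^+ 2 <= e by rewrite expr2 ler_piMl// ltW.
have k : 4 * F <= (4 * F - 4 * c * e ^+ 2) * (1 + e ^+ 4 * F ^+ 4).
  apply: le_trans avg _; rewrite ler_wpM2r// addr_ge0//.
  by rewrite mulr_ge0 ?exprn_even_ge0.
have k2 : c * e ^+ 2 <= F ^+ 5 * e ^+ 2 * e ^+ 2.
  have : 0 <= c * e ^+ 2 * (e ^+ 4 * F ^+ 4).
    by apply: mulr_ge0; apply: mulr_ge0; rewrite ?exprn_even_ge0 ?(ltW c0).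
  by rewrite F5; move: k; rewrite e4; lra.
have k3 : c <= F ^+ 5 * e ^+ 2 by rewrite -(ler_pM2r e2).
have F50 : 0 < F ^+ 5 by rewrite exprn_gt0.
nra.
Qed.

End GelfandMazur.
Section ContinuousFunctions.
Context {R : realType} {X : topologicalType}.
Implicit Types f g : X -> cplx R.

Lemma continuous_addC f g : continuous f -> continuous g ->
  continuous (fun x => f x + g x).
Proof. by move=> fc gc x; apply: cvgD; [exact: fc|exact: gc]. Qed.

Lemma continuous_mulC f g : continuous f -> continuous g ->
  continuous (fun x => f x * g x).
Proof. by move=> fc gc x; apply: cvgM; [exact: fc|exact: gc]. Qed.

Lemma continuous_cstC (z : cplx R) : continuous (fun _ : X => z).
Proof. by move=> x; exact: (@cvg_cst _ _ _ _ (nbhs_filter x)). Qed.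

Lemma continuous_oppC f : continuous f -> continuous (fun x => - f x).
Proof. by move=> fc x; apply: cvgN; exact: fc. Qed.

Lemma continuous_conjC f : continuous f -> continuous (fun x => (f x)^* : cplx R).
Proof.
move=> fc x; apply/(@cvgrPdist_lt _ (R[i]^o) _ _ (nbhs_filter x)) => e e0.
have := fc x; move=> /(@cvgrPdist_lt _ (R[i]^o) _ _ (nbhs_filter x))/(_ _ e0).
apply: (@filterS _ _ (nbhs_filter x)) => y /=.
by rewrite -rmorphB normcJ.
Qed.

Lemma closed_zeros f : continuous f -> closed [set x | f x = 0].
Proof.
move=> hc.
have -> : [set x | f x = 0] = (cabs \o f) @^-1` [set r | r <= 0].
  apply/seteqP; split=> x /=; first by move=> ->; rewrite cabs0.
  by move=> h0; apply: cabs_eq0; apply/eqP; rewrite eq_le h0 cabs_ge0.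
apply: preimage_closed; last exact: closed_le.
by move=> x _; apply: continuous_comp; [exact: hc|exact: cabs_continuous].
Qed.

End ContinuousFunctions.

(** * Characters, the spectral radius and compactness *)

Section Characters.
Context {R : realType} {A : comBanachAlgType R}.
Implicit Types (a b c x y : A) (z w : R[i]) (chi : max_ideal_space A).

Lemma make_character (f : A -> cplx R) :
  linear f -> monoid_morphism f -> exists chi, forall a, gelfand a chi = f a.
Proof.
move=> lf mf.
have h : (f : {ptws A -> cplx R}) \in @characters R A by rewrite inE.
by exists (SigSub h).
Qed.

Lemma gelfand_linear chi : linear (fun a => gelfand a chi).
Proof. by have [] := set_mem (valP chi). Qed.

Lemma gelfandM a b chi : gelfand (a * b) chi = gelfand a chi * gelfand b chi.
Proof. by have [_ [_]] := set_mem (valP chi); apply. Qed.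

Lemma gelfand1 chi : gelfand 1 chi = 1.
Proof. by have [_ []] := set_mem (valP chi). Qed.

Lemma gelfandD a b chi : gelfand (a + b) chi = gelfand a chi + gelfand b chi.
Proof. by have := gelfand_linear chi 1 a b; rewrite !scale1r. Qed.

Lemma gelfand0 chi : gelfand 0 chi = 0.
Proof. by have := gelfandD 0 0 chi; rewrite addr0 => /eqP; rewrite -subr_eq subrr => /eqP. Qed.

Lemma gelfandZ z a chi : gelfand (z *: a) chi = z * gelfand a chi.
Proof. by have := gelfand_linear chi z a 0; rewrite gelfand0 !addr0. Qed.

Lemma gelfandN a chi : gelfand (- a) chi = - gelfand a chi.
Proof. by rewrite -scaleN1r gelfandZ mulN1r. Qed.

Lemma gelfandB a b chi : gelfand (a - b) chi = gelfand a chi - gelfand b chi.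
Proof. by rewrite gelfandD gelfandN. Qed.

Lemma gelfandA z chi : gelfand (z%:A) chi = z.
Proof. by rewrite gelfandZ gelfand1 mulr1. Qed.

Lemma gelfand_nat n chi : gelfand n%:R chi = n%:R.
Proof. by elim: n => [|n ih]; rewrite ?gelfand0// !mulrS gelfandD gelfand1 ih. Qed.

Lemma gelfand_sum (J : Type) (s : seq J) (F : J -> A) chi :
  gelfand (\sum_(j <- s) F j) chi = \sum_(j <- s) gelfand (F j) chi.
Proof.
by elim: s => [|j s ih]; rewrite ?big_nil ?gelfand0// !big_cons gelfandD ih.
Qed.

Lemma scaleAE z a : z *: a = z%:A * a.
Proof. by rewrite -scalerAl mul1r. Qed.

(** Otherwise every [a - z%:A] would have an inverse modulo [I], which [no_resolvent] excludes. *)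
Lemma maximal_scalar I a : is_maximal I -> exists z, I (a - z%:A).
Proof.
move=> Imax; apply: contrapT => /forallNP n.
have [b bP] := choice (fun z => maximal_inverse Imax (n z)).
by case: Imax => Iid _; exact: no_resolvent bP.
Qed.

(** The character sends [a] to the scalar congruent to it modulo [I]; uniqueness of that scalar
    gives linearity and multiplicativity. *)
Lemma maximal_character I : is_maximal I ->
  exists chi, forall a, gelfand a chi = 0 <-> I a.
Proof.
move=> Imax; have [Iid _] := Imax; have [I0 ID IM I1] := Iid.
have [f fP] := choice (fun a => maximal_scalar a Imax).
have uniq a z : I (a - z%:A) -> f a = z.
  move=> h; apply/eqP; rewrite -subr_eq0; apply/negP => /negP d; apply: I1.
  have := ideal_sub Iid h (fP a).
  have -> : a - z%:A - (a - (f a)%:A) = (f a - z)%:A by rewrite scalerBl; ring.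
  move=> /(IM ((f a - z)^-1%:A)).
  by rewrite -scalerAl mul1r scalerA mulVf// scale1r.
have [||chi chiE] := @make_character f.
- move=> z a b; apply: uniq.
  have -> : z *: a + b - (z *: f a + f b)%:A =
      z%:A * (a - (f a)%:A) + (b - (f b)%:A).
    have -> : (z *: f a + f b)%:A = z%:A * (f a)%:A + (f b)%:A :> A.
      by rewrite -scaleAE scalerA -scalerDl.
    by rewrite scaleAE; ring.
  by apply: ID => //; exact: IM.
- split; first by apply: uniq; rewrite scale1r subrr.
  move=> a b; apply: uniq.
  have -> : a * b - (f a * f b)%:A = b * (a - (f a)%:A) + (f a)%:A * (b - (f b)%:A).
    by rewrite -scalerA scaleAE; ring.
  by apply: ID; exact: IM.
exists chi => a; rewrite chiE; split=> [fa|Ia].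
  by have := fP a; rewrite fa scale0r subr0.
by apply: uniq; rewrite scale0r subr0.
Qed.

Lemma invertibleP a : invertible a <-> forall chi, gelfand a chi != 0.
Proof.
split=> [[b ab] chi|h].
  apply/eqP => e; have := gelfand1 chi; rewrite -ab gelfandM e mul0r => /esym/eqP.
  by rewrite oner_eq0.
apply: contrapT => na.
have [|M Mmax sub] := @exists_maximal R A [set x | exists b, x = a * b].
  split.
  - by exists 0; rewrite mulr0.
  - by move=> _ _ [x ->] [y ->]; exists (x + y); rewrite mulrDr.
  - by move=> x _ [y ->]; exists (x * y); ring.
  - by move=> [b e]; apply: na; exists b.
have [chi chiE] := maximal_character Mmax.
have := h chi; rewrite (chiE a).2 ?eqxx//; apply: sub; exists 1.
by rewrite mulr1.
Qed.

Lemma invertible1 : invertible (1 : A).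
Proof. by exists 1; rewrite mulr1. Qed.

Lemma exists_character : exists chi : max_ideal_space A, True.
Proof.
apply: contrapT => /forallNP n.
have [|b] := (invertibleP 0).2; first by move=> chi; case: (n chi).
by rewrite mul0r => /esym/eqP; rewrite oner_eq0.
Qed.

(** If [|z| > nrm a], the Neumann series inverts [1 - z^-1 *: a], which [chi] sends to [0]. *)
Lemma gelfand_le_nrm a chi : cabs (gelfand a chi) <= nrm a.
Proof.
set z := gelfand a chi; rewrite leNgt; apply/negP => h.
have z0 : z != 0.
  by apply/eqP => e; move: h; rewrite e cabs0 ltNge nrm_ge0.
have [|b hb] := @one_sub_invertible R A (z^-1 *: a).
  by rewrite nrmZ cabsV ltr_pdivrMl ?mulr1// cabs_gt0.
have := gelfand1 chi; rewrite -hb gelfandM gelfandB gelfandZ gelfand1 -/z mulVf//.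
by rewrite subrr mul0r => /esym/eqP; rewrite oner_eq0.
Qed.

Lemma spectrumE a : spectrum a = range (gelfand a).
Proof.
apply/seteqP; split=> [z nz|_ [chi _ <-]].
  apply: contrapT => nr; apply: nz; apply/invertibleP => chi.
  by rewrite gelfandB gelfandA subr_eq0; apply/eqP => e; apply: nr; exists chi.
by move=> /invertibleP/(_ chi); rewrite gelfandB gelfandA subrr eqxx.
Qed.

Let spectrum_sup a : has_sup (cabs @` spectrum a).
Proof.
rewrite spectrumE; have [chi _] := exists_character; split.
  by exists (cabs (gelfand a chi)); exists (gelfand a chi) => //; exists chi.
by exists (nrm a) => _ [_ [psi _ <-] <-]; exact: gelfand_le_nrm.
Qed.

Lemma gelfand_le a chi : cabs (gelfand a chi) <= spectral_radius a.
Proof.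
apply: ub_le_sup; first by case: (spectrum_sup a).
by rewrite spectrumE; exists (gelfand a chi) => //; exists chi.
Qed.

Lemma spectral_radius_le a (c : R) : (forall chi, cabs (gelfand a chi) <= c) ->
  spectral_radius a <= c.
Proof.
move=> h; apply: ge_sup; first by case: (spectrum_sup a).
by rewrite spectrumE => _ [_ [psi _ <-] <-].
Qed.

Lemma spectral_radius_adherent a (e : R) : 0 < e ->
  exists chi, spectral_radius a - e < cabs (gelfand a chi).
Proof.
move=> e0; have [_ [z + <-] h] := sup_adherent e0 (spectrum_sup a).
by rewrite spectrumE => -[chi _ zE]; exists chi; rewrite zE.
Qed.

Lemma eq_spectral_radius a b : gelfand a = gelfand b ->
  spectral_radius a = spectral_radius b.
Proof. by move=> h; rewrite /spectral_radius !spectrumE h. Qed.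

(** Kernels of characters are maximal ideals, and every maximal ideal is such a kernel by
    [maximal_character]. *)
Lemma semisimpleP : @semisimple R A <->
  forall a, (forall chi, gelfand a chi = 0) -> a = 0.
Proof.
split=> [ss a a0|inj a aI]; last first.
  apply: inj => chi; apply/eqP.
  apply: (aI [pred x | gelfand x chi == 0]).
  split; first split.
  - by rewrite inE gelfand0.
  - by rewrite inE gelfand1 oner_eq0.
  - by move=> x u v; rewrite !inE gelfandD gelfandM => /eqP -> /eqP ->; rewrite mulr0 addr0.
  move=> J [J0 J1 JM] sub x; apply/idP/idP; last exact: sub.
  move=> Jx; rewrite inE; apply: contraNT J1 => x0.
  have k : 1 - (gelfand x chi)^-1%:A * x \in J.
    apply: sub; rewrite inE gelfandB gelfand1 gelfandM gelfandA mulVf// subrr.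
    by [].
  have := JM ((gelfand x chi)^-1%:A) _ _ Jx k.
  by rewrite addrC subrK.
apply: ss => I [[I0 I1 IM] Imax].
have mulI x y : y \in I -> x * y \in I.
  by move=> Iy; have := IM x _ _ Iy I0; rewrite addr0.
have addI x y : x \in I -> y \in I -> x + y \in I.
  by move=> Ix Iy; have := IM 1 _ _ Ix Iy; rewrite mul1r.
have [|chi chiE] := @maximal_character [set` I].
  split; first by split=> //=; exact/negP.
  move=> J [J0 JD JM J1] sub x Jx /=.
  pose J' : {pred A} := [pred x | `[< J x >]].
  have <- : J' x = (x \in I).
    apply: (Imax J').
      split; [exact/asboolP| |].
        by apply/negP => /asboolP.
      by move=> c u v /asboolP Ju /asboolP Jv; apply/asboolP/JD => //; exact: JM.
    by move=> y Iy; apply/asboolP/sub.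
  exact/asboolP.
exact/(chiE a).
Qed.

Lemma gelfand_continuous a : continuous (gelfand a).
Proof.
move=> chi; apply: (@continuous_comp _ _ _
  (set_val : max_ideal_space A -> {ptws A -> cplx R}) (fun f : {ptws A -> cplx R} => f a)).
  exact: initial_continuous.
exact: proj_continuous.
Qed.

Lemma characters_closed : closed (@characters R A).
Proof.
have ev (a : A) : continuous (fun f : {ptws A -> cplx R} => f a).
  exact: proj_continuous.
have -> : @characters R A =
    (\bigcap_(p : R[i] * (A * A))
      [set f : {ptws A -> cplx R} | f (p.1 *: p.2.1 + p.2.2) - (p.1 * f p.2.1 + f p.2.2) = 0])
    `&` ([set f : {ptws A -> cplx R} | f 1 - 1 = 0] `&`
    (\bigcap_(p : A * A) [set f : {ptws A -> cplx R} | f (p.1 * p.2) - f p.1 * f p.2 = 0])).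
  apply/seteqP; split=> f.
    move=> [lf [f1 fM]]; split; [|split].
    - by move=> [z [x y]] _ /=; rewrite lf subrr.
    - by rewrite /= f1 subrr.
    - by move=> [x y] _ /=; rewrite fM subrr.
  move=> [lf [f1 fM]]; split; [|split].
  - by move=> z x y; apply/eqP; rewrite -subr_eq0; apply/eqP/(lf (z, (x, y))).
  - by apply/eqP; rewrite -subr_eq0; apply/eqP.
  - by move=> x y; apply/eqP; rewrite -subr_eq0; apply/eqP/(fM (x, y)).
have cst (z : cplx R) := @continuous_cstC R {ptws A -> cplx R} z.
apply: closedI; last apply: closedI.
- apply: closed_bigI => -[z [x y]] _.
  apply: (@closed_zeros R {ptws A -> cplx R}
    (fun f => f (z *: x + y) + - (z * f x + f y))).
  apply: continuous_addC; first exact: ev.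
  apply: continuous_oppC; apply: continuous_addC; last exact: ev.
  by apply: continuous_mulC; [exact: cst|exact: ev].
- apply: (@closed_zeros R {ptws A -> cplx R} (fun f => f 1 + - 1)).
  apply: continuous_addC; first exact: ev.
  exact: cst.
- apply: closed_bigI => -[x y] _.
  apply: (@closed_zeros R {ptws A -> cplx R} (fun f => f (x * y) + - (f x * f y))).
  apply: continuous_addC; first exact: ev.
  by apply: continuous_oppC; apply: continuous_mulC; exact: ev.
Qed.

(** By [gelfand_le_nrm] the characters form a closed subset of the product of the discs of radius
    [nrm a], which is compact by Tychonoff's theorem. *)
Lemma characters_compact : compact (@characters R A).
Proof.
apply: (@subclosed_compact _ _ [set f : {ptws A -> cplx R} |
    forall a, [set z : cplx R | cabs z <= nrm a] (f a)]).
- exact: characters_closed.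
- apply: (@tychonoff A (fun=> cplx R) (fun a => [set z : cplx R | cabs z <= nrm a])).
  by move=> a; exact: (@compact_disc R).
move=> f Kf a; have Kf' : f \in @characters R A by rewrite inE.
exact: (gelfand_le_nrm a (SigSub Kf' : max_ideal_space A)).
Qed.

Lemma continuous_bounded (F : max_ideal_space A -> cplx R) : continuous F ->
  exists K : R, forall chi, cabs (F chi) <= K.
Proof.
move=> Fc.
(* The function is extended by [0] to the whole product space, so that the extreme value theorem
   applies on the compact set of characters. *)
have /(@subspace_valL_continuousP' _ _ _ 0) cF :
  continuous (cabs \o F : set_type (@characters R A) -> R).
  by move=> x; apply: continuous_comp; [exact: Fc|exact: cabs_continuous].
have [chi0 _] := exists_character.
have [|c _ cmax] := compact_EVT_max _ characters_compact cF.
  by exists (set_val chi0); exact: set_valP.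
exists (valL_ 0 (cabs \o F : set_type (@characters R A) -> R) c) => chi.
have := cmax (set_val chi) (valP chi).
have := @valLK _ _ 0 (@characters R A) (cabs \o F : set_type (@characters R A) -> R).
by move=> /(congr1 (fun g => g chi)); rewrite /sigL /= => ->.
Qed.

End Characters.
Local Notation "a $ x" := (gelfand a x) (at level 10, x at level 9, format "a $ x").

(** * Peaks and the transfer principle *)

Section DiscEstimates.
Context {R : realType}.
Implicit Types (z w h : cplx R) (r : R).

(** Inversion maps the half-plane [Re h >= 1] into the disc with diameter [[0, 1]]; hence the
    interest of peaks of the form [1/h]. *)
Lemma inv_in_disc h : 1 <= complex.Re h -> cabs (h^-1 - (2^-1)%:C) <= 2^-1.
Proof.
move=> h1; have h0 : h != 0 by apply/eqP => e; move: h1; rewrite e /= ler10.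
have -> : h^-1 - (2^-1)%:C = (2^-1)%:C * ((2%:C - h) / h).
  by rewrite mulrBl divff// mulrBr mulr1 mulrA -rmorphM mulVf ?pnatr_eq0// mul1r.
rewrite cabsM cabs_real ger0_norm ?invr_ge0// ler_piMr ?invr_ge0//.
rewrite cabsM cabsV ler_pdivrMr ?cabs_gt0// mul1r.
rewrite cabs_le ?cabs_ge0// sqr_cabs; case: h h1 {h0} => a b /= a1.
nra.
Qed.

Lemma disc_bound z h : 1 <= complex.Re h ->
  cabs (z / h - 1) <= cabs z / 2 + cabs (z * (2^-1)%:C - 1).
Proof.
move=> /inv_in_disc h1.
have -> : z / h - 1 = z * (h^-1 - (2^-1)%:C) + (z * (2^-1)%:C - 1) by ring.
by apply: le_trans (cabsD _ _) _; rewrite lerD2r cabsM ler_wpM2l ?cabs_ge0.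
Qed.

Lemma disc_bound_real (N : R) h : 2 <= N -> 1 <= complex.Re h ->
  cabs (N%:C / h - 1) <= N - 1.
Proof.
move=> N2 /(disc_bound N%:C) /le_trans; apply.
rewrite -rmorphM -(rmorph1 (real_complex R)) -rmorphB !cabs_real !ger0_norm; lra.
Qed.

(* [N] is the only point of modulus [N] of the disc [|w - 1| <= N - 1]. *)
Lemma near_disc_tip (N d : R) w : 1 <= N -> 0 <= d <= N -> cabs (w - 1) <= N - 1 ->
  N - d <= cabs w -> cabs (w - N%:C) ^+ 2 <= 2 * N ^+ 2 * d.
Proof.
move=> N1 /andP[d0 dN] /le_cabs; rewrite subr_ge0 => /(_ N1) h1 h2.
have : (N - d) ^+ 2 <= cabs w ^+ 2 by rewrite ler_sqr ?nnegrE ?cabs_ge0 ?subr_ge0.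
rewrite !sqr_cabs; case: w h1 {h2} => a b /= h1 h2.
have h3 : 0 <= (N - 1) * (a ^+ 2 + b ^+ 2 - (N - d) ^+ 2) by rewrite mulr_ge0; lra.
have h4 : 0 <= N * ((N - 1) ^+ 2 - ((a - 1) ^+ 2 + (b - 0) ^+ 2)) by rewrite mulr_ge0; lra.
have h5 : 0 <= N * d by rewrite mulr_ge0; lra.
have h6 : 0 <= (N - 1) * d ^+ 2 by rewrite mulr_ge0 ?sqr_ge0; lra.
lra.
Qed.

(** The left-hand side is the component of [w - 1] in the direction of [w]. *)
Lemma le_cabs_sub1 w : w != 0 -> cabs w - complex.Re w / cabs w <= cabs (w - 1).
Proof.
move=> w0; have c0 := cabs_gt0 w0.
have := sqr_cabs w; have := sqr_cabs (w - 1); set c := cabs w in c0 *.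
set d := cabs _ => h1 h2; have d0 : 0 <= d := cabs_ge0 _.
have -> : c - complex.Re w / c = (c ^+ 2 - complex.Re w) / c by field; rewrite gt_eqF.
rewrite ler_pdivrMr//; move: h1 h2; case: (w) => a b /= h1 h2.
have h3 : (c ^+ 2 - a) ^+ 2 <= (d * c) ^+ 2.
  by rewrite exprMn h1 h2; have := sqr_ge0 b; nra.
by case: (leP (c ^+ 2 - a) 0) => h; [apply: le_trans h _; rewrite mulr_ge0// ltW|
  rewrite -ler_sqr// nnegrE ?mulr_ge0// ltW].
Qed.

(** From [2 |w| |w - 1| <= |w|^2 + |w - 1|^2]. With [le_cabs_sub1] this expands [|w - 1|] up to an
    error [O(1/|w|)], and the second term records the direction of [w]. *)
Lemma cabs_sub1_le w : w != 0 ->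
  cabs (w - 1) <= cabs w - complex.Re w / cabs w + (2 * cabs w)^-1.
Proof.
move=> w0; have c0 := cabs_gt0 w0.
have := sqr_cabs w; have := sqr_cabs (w - 1); set c := cabs w in c0 *.
set d := cabs _ => h1 h2.
have -> : c - complex.Re w / c + (2 * c)^-1 = (2 * c ^+ 2 - 2 * complex.Re w + 1) / (2 * c).
  by field; rewrite gt_eqF.
rewrite ler_pdivlMr ?mulr_gt0//; move: h1 h2; case: (w) => a b /= h1 h2.
have := sqr_ge0 (c - d); lra.
Qed.

End DiscEstimates.

Section Inverse.
Context {R : realType} {A : comBanachAlgType R}.
Implicit Types (a b : A) (x : max_ideal_space A).

Definition binv a : A := xget 0 [set b | a * b = 1].

Lemma mulr_binv a : invertible a -> a * binv a = 1.
Proof. by move=> [b ab]; rewrite /binv; case: xgetP => [c _ //|/(_ b)]. Qed.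

Lemma binvE a b : a * b = 1 -> binv a = b.
Proof.
move=> ab; have ia : invertible a by exists b.
transitivity (binv a * (a * b)); first by rewrite ab mulr1.
by rewrite mulrA (mulrC (binv a)) mulr_binv// mul1r.
Qed.

Lemma invertible_neq0 a x : invertible a -> a$x != 0.
Proof. by move=> /invertibleP. Qed.

Lemma binv_invertible a : invertible a -> invertible (binv a).
Proof. by move=> ia; exists a; rewrite mulrC mulr_binv. Qed.

Lemma gelfand_binv a x : invertible a -> (binv a)$x = (a$x)^-1.
Proof.
move=> ia; apply: (mulfI (invertible_neq0 x ia)).
by rewrite -gelfandM mulr_binv// gelfand1 divff// invertible_neq0.
Qed.

Lemma invertibleM a b : invertible a -> invertible b -> invertible (a * b).
Proof.
by move=> /invertibleP ha /invertibleP hb; apply/invertibleP => x; rewrite gelfandM mulf_neq0.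
Qed.

Lemma invertibleN a : invertible a -> invertible (- a).
Proof. by move=> /invertibleP ha; apply/invertibleP => x; rewrite gelfandN oppr_eq0. Qed.

Lemma invertible_scalar (z : R[i]) : z != 0 -> invertible (z%:A : A).
Proof. by move=> z0; apply/invertibleP => x; rewrite gelfandA. Qed.

Lemma gelfand_inj a b : @semisimple R A -> (forall x, a$x = b$x) -> a = b.
Proof.
move=> /semisimpleP ss h; apply/eqP; rewrite -subr_eq0; apply/eqP/ss => x.
by rewrite gelfandB h subrr.
Qed.

End Inverse.

Section Peak.
Context {R : realType} {B : comBanachAlgType R}.
Implicit Types (us : seq B) (y : max_ideal_space B).

Definition energy us y : R := \sum_(u <- us) cabs (u$y) ^+ 2.
Definition gap us y y' : R := \sum_(u <- us) cabs (u$y' - u$y) ^+ 2.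

Lemma energy_le us y : energy us y <= \sum_(u <- us) nrm u ^+ 2.
Proof.
by apply: ler_sum => u _; rewrite ler_sqr ?nnegrE ?cabs_ge0 ?nrm_ge0// gelfand_le_nrm.
Qed.

Lemma Re_sum (J : Type) (s : seq J) (F : J -> cplx R) :
  complex.Re (\sum_(j <- s) F j) = \sum_(j <- s) complex.Re (F j).
Proof.
elim: s => [|j s ih]; rewrite ?big_nil// !big_cons -ih.
by move: (F j) (\sum_(j <- s) F j) => [a b] [c d].
Qed.

(* A point [y] of nearly maximal energy is nearly exposed by the linear form
   [<., u(y)>], since [|u(y') - u(y)|^2 = |u(y')|^2 + |u(y)|^2 - 2 Re <u(y'), u(y)>]. *)
Lemma exists_peak us (t : R) : 0 < t -> exists y (h : B),
  [/\ forall y', 1 + gap us y y' / t ^+ 2 <= complex.Re (h$y'),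
      exists2 s, 0 <= s <= t & h$y = (1 + s)%:C
    & forall y', energy us y' <= energy us y + t].
Proof.
move=> t0; have [y0 _] := @exists_character R B.
have es : has_sup (range (energy us)).
  split; first by exists (energy us y0); exists y0.
  by exists (\sum_(u <- us) nrm u ^+ 2) => _ [y _ <-]; exact: energy_le.
pose S := sup (range (energy us)).
have eS y : energy us y <= S by apply: ub_le_sup; [case: es|exists y].
pose k := 2 / t ^+ 2; have t2 : 0 < t ^+ 2 by rewrite exprn_gt0.
have k0 : 0 < k by rewrite divr_gt0.
(* The bound [t] serves the energy estimate; [t ^+ 3 / 2] gives [k * d <= t], hence
   [h(y) <= 1 + t]. *)
pose d := Num.min t (t ^+ 3 / 2).
have d0 : 0 < d by rewrite lt_min t0 divr_gt0// exprn_gt0.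
have [_ [y _ <-] yS] := sup_adherent d0 es; rewrite -/S in yS.
have dt : d <= t by rewrite ge_min lexx.
have dk : k * d <= t.
  have : d <= t ^+ 3 / 2 by rewrite ge_min lexx orbT.
  rewrite -(ler_pM2l k0) => /le_trans; apply.
  by rewrite le_eqVlt /k; apply/orP; left; apply/eqP; field; rewrite gt_eqF.
(* As both energies are at most [S], half of the gap is at most [S - Re <u(y'), u(y)>]; the factor
   [k] turns it into [gap / t ^+ 2]. *)
pose h : B := 1 + k%:C *: (S%:C%:A - \sum_(u <- us) (u$y)^* *: u).
have hE y' : h$y' = 1 + k%:C * (S%:C - \sum_(u <- us) (u$y)^* * u$y').
  rewrite gelfandD gelfand1 gelfandZ gelfandB gelfandA gelfand_sum.
  by under eq_bigr do rewrite gelfandZ.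
exists y, h; split.
- move=> y'; rewrite hE.
  have -> : complex.Re (1 + k%:C * (S%:C - \sum_(u <- us) (u$y)^* * u$y')) =
      1 + k * (S - \sum_(u <- us) complex.Re ((u$y)^* * u$y')).
    by rewrite -Re_sum; case: (\sum_(u <- us) _) => a b /=; ring.
  have gE : gap us y y' = energy us y' + energy us y -
      2 * \sum_(u <- us) complex.Re ((u$y)^* * u$y').
    rewrite /gap /energy mulr_sumr -big_split /= -sumrB; apply: eq_bigr => u _.
    by rewrite !sqr_cabs; case: (u$y) => a b; case: (u$y') => c e /=; ring.
  have h2 : gap us y y' / 2 <= S - \sum_(u <- us) complex.Re ((u$y)^* * u$y').
    by rewrite gE; have := eS y; have := eS y'; lra.
  rewrite lerD2l; have -> : gap us y y' / t ^+ 2 = k * (gap us y y' / 2).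
    by rewrite /k; field; rewrite gt_eqF.
  by rewrite ler_pM2l.
- exists (k * (S - energy us y)).
    rewrite mulr_ge0 ?subr_ge0 ?(ltW k0)//=; apply: le_trans dk.
    by rewrite ler_pM2l//; lra.
  rewrite hE /energy.
  have -> : \sum_(u <- us) (u$y)^* * u$y = (\sum_(u <- us) cabs (u$y) ^+ 2)%:C.
    rewrite rmorph_sum; apply: eq_bigr => u _; rewrite sqr_cabs.
    by case: (u$y) => a b; apply/eqP; rewrite eq_complex /=; apply/andP; split; apply/eqP; ring.
  by apply/eqP; rewrite eq_complex /=; apply/andP; split; apply/eqP; ring.
- by move=> y'; have := eS y'; lra.
Qed.

End Peak.

(** * Normalized maps preserving the spectral radius of [f g - 1] *)

Lemma gelfandM_sub1 {R : realType} {A : comBanachAlgType R} (a b : A) x :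
  (a * b - 1)$x = a$x * b$x - 1.
Proof. by rewrite gelfandB gelfandM gelfand1. Qed.

(** By the parallelogram law [|w + 1|^2 + |w - 1|^2 = 2 |w|^2 + 2], the last two bounds give
    [|w|^2 <= 9/7], hence [|w - 1|^2 <= 4/7], against the first. *)
Lemma three_discs {R : realType} (w : cplx R) : 2 - 4^-1 < cabs (w - 1) ->
  cabs (1 + w) <= 2 -> cabs (w - 1) <= 2 / 3 * cabs w -> False.
Proof.
have := sqr_cabs w; have := sqr_cabs (w - 1); have := sqr_cabs (1 + w).
have := cabs_ge0 w; have := cabs_ge0 (w - 1); have := cabs_ge0 (1 + w).
move: (cabs w) (cabs (w - 1)) (cabs (1 + w)); case: w => p q c d e /=.
move=> e0 d0 c0 sq2 sq1 sq h1 h2 h3.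
have k1 : e ^+ 2 <= 4 by nra.
have k2 : d ^+ 2 > 49 / 16 by nra.
have k3 : d ^+ 2 <= 4 / 9 * c ^+ 2 by nra.
nra.
Qed.

(** A point within [sqrt 2] of both [1] and [-1] has modulus at most [1]. Here this holds for
    [a + bi] and for its inverse [c + di], so both have modulus [1], and the two discs meet the unit
    circle in [i] and [-i] only. *)
Lemma half_turn_arith {R : realType} (a b c d : R) :
  (a + 1) ^+ 2 + b ^+ 2 <= 2 -> (a - 1) ^+ 2 + b ^+ 2 <= 2 ->
  (c + 1) ^+ 2 + d ^+ 2 <= 2 -> (c - 1) ^+ 2 + d ^+ 2 <= 2 ->
  c * a - d * b = 1 -> c * b + d * a = 0 -> a = 0 /\ (b = 1 \/ b = -1).
Proof.
move=> h1 h2 h3 h4 k1 k2.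
have r1 : a ^+ 2 + b ^+ 2 <= 1 by lra.
have r2 : c ^+ 2 + d ^+ 2 <= 1 by lra.
have r3 : (a ^+ 2 + b ^+ 2) * (c ^+ 2 + d ^+ 2) = 1.
  have -> : (a ^+ 2 + b ^+ 2) * (c ^+ 2 + d ^+ 2) =
    (c * a - d * b) ^+ 2 + (c * b + d * a) ^+ 2 by ring.
  by rewrite k1 k2; ring.
have r4 : a ^+ 2 + b ^+ 2 = 1 by nra.
have a0 : a = 0 by nra.
split=> //; have : (b - 1) * (b + 1) = 0 by rewrite a0 in r4; lra.
by move/eqP; rewrite mulf_eq0 subr_eq0 addr_eq0 => /orP[/eqP ->|/eqP ->]; [left|right].
Qed.

Definition radius_preserver {R : realType} {A B : comBanachAlgType R} (T : A -> B) :=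
  [/\ forall f, invertible f -> invertible (T f),
      forall g, invertible g -> exists2 f, invertible f & T f = g,
      T 1 = 1
    & forall f g, invertible f -> invertible g ->
        spectral_radius (T f * T g - 1) = spectral_radius (f * g - 1)].

Section Preserver.
Context {R : realType} {A B : comBanachAlgType R} (T : A -> B).
Hypothesis ssB : @semisimple R B.
Hypothesis T_preserver : radius_preserver T.

Let T_inv f : invertible f -> invertible (T f).
Proof. by case: T_preserver => + _ _ _; exact. Qed.

Let T_surj g : invertible g -> exists2 f, invertible f & T f = g.
Proof. by case: T_preserver => _ + _ _; exact. Qed.

Let T1 : T 1 = 1.
Proof. by case: T_preserver. Qed.

Let T_radius f g : invertible f -> invertible g ->
  spectral_radius (T f * T g - 1) = spectral_radius (f * g - 1).
Proof. by case: T_preserver => _ _ _; exact. Qed.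

Implicit Types (f g : A) (x : max_ideal_space A) (y : max_ideal_space B).

(** For a normalized map the equality of radii is used only through this lemma and the next two:
    uniform bounds on [f g - 1] pass between the two sides, and a value on the [B] side is nearly
    reached in modulus at some point on the [A] side. *)
Lemma T_le f g c : invertible f -> invertible g ->
  (forall y, cabs ((T f)$y * (T g)$y - 1) <= c) ->
  forall x, cabs (f$x * g$x - 1) <= c.
Proof.
move=> fi gi h x; rewrite -gelfandM_sub1.
apply: le_trans (gelfand_le _ _) _; rewrite -T_radius//.
by apply: spectral_radius_le => y; rewrite gelfandM_sub1.
Qed.

Lemma T_ge f g c : invertible f -> invertible g ->
  (forall x, cabs (f$x * g$x - 1) <= c) ->
  forall y, cabs ((T f)$y * (T g)$y - 1) <= c.
Proof.
move=> fi gi h y; rewrite -gelfandM_sub1.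
apply: le_trans (gelfand_le _ _) _; rewrite T_radius//.
by apply: spectral_radius_le => x; rewrite gelfandM_sub1.
Qed.

Lemma T_adherent f g y (d : R) : invertible f -> invertible g -> 0 < d ->
  exists x, cabs ((T f)$y * (T g)$y - 1) - d < cabs (f$x * g$x - 1).
Proof.
move=> fi gi d0; have [x hx] := spectral_radius_adherent (f * g - 1) d0.
exists x; rewrite -!gelfandM_sub1; apply: le_lt_trans hx.
by rewrite lerD2r -T_radius//; exact: gelfand_le.
Qed.

Lemma T_binvE f y : invertible f -> (T (binv f))$y = ((T f)$y)^-1.
Proof.
move=> fi; have fi' := binv_invertible fi.
have e0 x : cabs (f$x * (binv f)$x - 1) <= 0.
  by rewrite gelfand_binv// divff ?invertible_neq0// subrr cabs0.
have h := T_ge fi fi' e0 y; have n0 := invertible_neq0 y (T_inv fi).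
apply: (mulfI n0); rewrite divff//.
apply/eqP; rewrite -subr_eq0; apply/eqP/cabs_eq0/eqP.
by rewrite eq_le h cabs_ge0.
Qed.

(** As [-1] is its own inverse, [u ^+ 2 = 1] for [u = T (-1)]. Suppose [u(y) = 1] and let
    [TE = 2 + u]. Then [TE * u - 1 = 2 u] gives [|E + 1| <= 2] everywhere,
    [(TE)^-1 - 1 = - (1 + u) / 3] gives [|E - 1| <= 2/3 |E|] everywhere, and [TE(y) - 1 = 2] gives a
    point where [|E - 1| > 2 - 1/4]: impossible by [three_discs]. *)
Lemma T_neg1 : T (-1) = -1.
Proof.
have i1 := @invertible1 R A; have iN1 := invertibleN i1.
set u := T (-1).
have u2 y : u$y * u$y = 1.
  have bN1 : binv (-1 : A) = -1 by apply: binvE; rewrite mulrNN mulr1.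
  by have := T_binvE y iN1; rewrite bN1 -/u => {2}->; rewrite divff// invertible_neq0//; exact: T_inv.
apply: (gelfand_inj ssB) => y; rewrite gelfandN gelfand1.
apply: contrapT => uyN1.
have uy : u$y = 1.
  have : (u$y - 1) * (u$y + 1) = 0 by rewrite mulrBl !mulrDr u2 mulr1 mul1r; ring.
  move/eqP; rewrite mulf_eq0 subr_eq0 => /orP[/eqP//|].
  by rewrite addr_eq0 => /eqP.
(* The element equal to [3] where [u = 1] and to [1] where [u = -1]. *)
pose G := 2%:R + u.
have Gu y' : G$y' * (2%:R - u$y') = 3%:R.
  by rewrite gelfandD gelfand_nat; have := u2 y' => e; ring: e.
have cu y' : cabs (u$y') = 1.
  have := congr1 cabs (u2 y'); rewrite cabsM cabs1 => e.
  have := cabs_ge0 (u$y'); nra.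
have three : cabs (3%:R : cplx R) = 3.
  by rewrite -(rmorph_nat (real_complex R)) cabs_real ger0_norm.
have two : cabs (2%:R : cplx R) = 2.
  by rewrite -(rmorph_nat (real_complex R)) cabs_real ger0_norm.
have Gi : invertible G.
  apply/invertibleP => y'; apply/eqP => e; have := Gu y'.
  by rewrite e mul0r => /eqP; rewrite eq_sym pnatr_eq0.
have [E Ei TE] := T_surj Gi; have Ei' := binv_invertible Ei.
have h1 x : cabs (E$x * (-1)$x - 1) <= 2.
  apply: T_le => // y'; rewrite TE -/u gelfandD gelfand_nat.
  have -> : (2%:R + u$y') * u$y' - 1 = 2%:R * u$y'.
    by have e := u2 y'; ring: e.
  by rewrite cabsM two cu mulr1.
have h2 x : cabs ((binv E)$x * 1$x - 1) <= 2 / 3.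
  apply: T_le => // y'; rewrite T1 T_binvE// TE gelfand1 mulr1.
  have n3 : 3%:R != 0 :> cplx R by rewrite pnatr_eq0.
  have -> : (G$y')^-1 = (2%:R - u$y') / 3%:R.
    apply: (mulfI (invertible_neq0 y' Gi)).
    by rewrite mulrA Gu !divff// invertible_neq0.
  have -> : (2%:R - u$y') / 3%:R - 1 = - (1 + u$y') / 3%:R by field.
  rewrite cabsM cabsN cabsV three ler_pM2r ?invr_gt0//.
  by apply: le_trans (cabsD _ _) _; rewrite cabs1 cu.
have q0 : (0 : R) < 4^-1 by rewrite invr_gt0.
have [x hx] := T_adherent y Ei i1 q0.
move: hx; rewrite TE T1 !gelfand1 !mulr1 gelfandD gelfand_nat uy.
have -> : 2%:R + 1 - 1 = 2%:R :> cplx R by ring.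
rewrite two => hx.
have h4 : cabs (1 + E$x) <= 2.
  by have := h1 x; rewrite gelfandN gelfand1 mulrN1 -cabsN opprB opprK.
have := h2 x; rewrite gelfand1 mulr1 gelfand_binv// => h3.
have Ex := invertible_neq0 x Ei.
have {}h3 : cabs (1 - E$x) <= 2 / 3 * cabs (E$x).
  rewrite -ler_pdivrMr ?cabs_gt0// -cabsV -cabsM.
  by rewrite mulrBl divff// mul1r.
move: hx h3 h4; rewrite (cabsC 1) => hx h3 h4.
exact: (three_discs hx h4 h3).
Qed.

(** [i] and its inverse lie within [sqrt 2] of [1] and of [-1], which [T] fixes; so do their images,
    and [half_turn_arith] applies. *)
Lemma T_i_unit y : (T 'i%C%:A)$y = 'i%C \/ (T 'i%C%:A)$y = - 'i%C.
Proof.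
have i0 : 'i%C != 0 :> R[i] by rewrite eq_complex /= oner_eq0 andbF.
have ii := @invertible_scalar R A _ i0; have i1 := @invertible1 R A.
have iN1 := invertibleN i1; have ii' := binv_invertible ii.
have bi x : (binv ('i%C%:A : A))$x = - 'i%C.
  rewrite gelfand_binv// gelfandA; apply: (mulfI i0).
  by rewrite divff// mulrN -expr2 sqr_i opprK.
have s2 (z : cplx R) : complex.Re z ^+ 2 = 1 -> complex.Im z ^+ 2 = 1 -> cabs z <= Num.sqrt 2.
  by move=> h1 h2; apply: cabs_le; rewrite ?sqrtr_ge0// sqr_sqrtr// h1 h2.
have e1 x : cabs (('i%C%:A : A)$x * 1$x - 1) <= Num.sqrt 2.
  by rewrite gelfandA gelfand1 mulr1; apply: s2 => /=; ring.
have e2 x : cabs (('i%C%:A : A)$x * (-1)$x - 1) <= Num.sqrt 2.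
  by rewrite gelfandA gelfandN gelfand1 mulrN1; apply: s2 => /=; ring.
have e3 x : cabs ((binv ('i%C%:A : A))$x * 1$x - 1) <= Num.sqrt 2.
  by rewrite bi gelfand1 mulr1; apply: s2 => /=; ring.
have e4 x : cabs ((binv ('i%C%:A : A))$x * (-1)$x - 1) <= Num.sqrt 2.
  by rewrite bi gelfandN gelfand1 mulrN1; apply: s2 => /=; ring.
move: (T_ge ii i1 e1 y) (T_ge ii iN1 e2 y) (T_ge ii' i1 e3 y) (T_ge ii' iN1 e4 y).
rewrite T1 T_neg1 T_binvE// gelfandN gelfand1 !mulr1 !mulrN1.
have J0 := invertible_neq0 y (T_inv ii); set J := _$y in J0 * => h1 h2 h3 h4.
have sq : Num.sqrt 2 ^+ 2 = 2 :> R by rewrite sqr_sqrtr.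
have := le_cabs (sqrtr_ge0 _) h1; have := le_cabs (sqrtr_ge0 _) h2.
have := le_cabs (sqrtr_ge0 _) h3; have := le_cabs (sqrtr_ge0 _) h4; rewrite sq.
have JV : J^-1 * J = 1 by rewrite mulVf.
move: (J^-1) JV => K; case: (J) => a b; case: K => c d [] k1 k2 /= g4 g3 g2 g1.
have [-> [->|->]] : a = 0 /\ (b = 1 \/ b = -1).
  by apply: (half_turn_arith (c := c) (d := d)) => //; lra.
  by left.
by right; rewrite /GRing.opp /= oppr0.
Qed.

Definition quarter_turns : seq R[i] := [:: 1; -1; 'i%C; - 'i%C].

Lemma quarter_turns_neq0 z : z \in quarter_turns -> z != 0.
Proof.
have i0 : 'i%C != 0 :> R[i] by rewrite eq_complex /= oner_eq0 andbF.
by rewrite !inE => /or4P[] /eqP ->; rewrite ?oppr_eq0 ?oner_eq0.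
Qed.

Lemma cabs_quarter_turns z : z \in quarter_turns -> cabs (z : cplx R) = 1.
Proof. by rewrite !inE => /or4P[] /eqP ->; rewrite ?cabsN ?cabs1 ?cabs_i. Qed.

Lemma T_turnV z y : z != 0 -> (T (z^-1)%:A)$y = ((T z%:A)$y)^-1.
Proof.
move=> z0; have iz := @invertible_scalar R A _ z0.
rewrite -T_binvE// (@binvE _ _ _ (z^-1)%:A)//.
by rewrite -scaleAE scalerA divff// scale1r.
Qed.

Lemma T_turnNi y : (T (- 'i%C)%:A)$y = - (T 'i%C%:A)$y.
Proof.
have i0 : 'i%C != 0 :> R[i] by rewrite eq_complex /= oner_eq0 andbF.
have iV : ('i%C)^-1 = - 'i%C :> R[i].
  by apply: (mulfI i0); rewrite divff// mulrN -expr2 sqr_i opprK.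
by rewrite -iV T_turnV//; case: (T_i_unit y) => ->; rewrite ?invrN iV ?opprK.
Qed.

Lemma T_turn_unit z y : z \in quarter_turns -> cabs ((T z%:A)$y) = 1.
Proof.
rewrite !inE => /or4P[] /eqP ->.
- by rewrite scale1r T1 gelfand1 cabs1.
- by rewrite scaleN1r T_neg1 gelfandN gelfand1 cabsN cabs1.
- by case: (T_i_unit y) => ->; rewrite ?cabsN cabs_i.
- by rewrite T_turnNi cabsN; case: (T_i_unit y) => ->; rewrite ?cabsN cabs_i.
Qed.

(** The elements to be held near their values at the peak. The factors [T z%:A] are included because
    the sign in [T i = +-i] may vary with the point. *)
Definition turned (fs : seq A) : seq B :=
  [seq T f * T z%:A | f <- fs, z <- quarter_turns].

(** One pair of points serves all [f] and [z]. The right-hand side is the bound of [disc_bound] for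
    [N * Tf(y) * Tz(y)], up to [N^-1]; the left-hand side comes from [f E - 1] at [x], where [E(x)]
    is nearly [z N]. The first conclusion lets the caller keep [D] away from [0] at [y]. *)
Lemma nearly_exposed_pair (fs : seq A) (D : B) (K N : R) : 1 <= K -> 2 <= N ->
  (forall f, f \in fs -> invertible f /\ nrm f <= K) ->
  exists y x,
    (forall y', energy (D :: turned fs) y' <= energy (D :: turned fs) y + 1) /\
    forall f z, f \in fs -> z \in quarter_turns ->
      cabs (N%:C * (z * f$x) - 1) <= N * cabs ((T f)$y) / 2 +
        cabs (N%:C * ((T f)$y * (T z%:A)$y) * (2^-1)%:C - 1) + N^-1.
Proof.
(* The constant is chosen so that [8 * N ^+ 4 * t = (2 * K * N)^-1 ^+ 2] and [N * t <= (2 * N)^-1],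
   the two error terms below. *)
move=> K1 N2 fsP; pose t := (32 * K ^+ 2 * N ^+ 6)^-1.
have N0 : 0 < N by lra.
have K0 : 0 < K by lra.
have t0 : 0 < t by rewrite invr_gt0 !mulr_gt0// exprn_gt0.
have [y [h [hgap [s /andP[s0 st] hy] hE]]] := exists_peak (D :: turned fs) t0.
have h1 y' : 1 <= complex.Re (h$y').
  apply: le_trans (hgap y'); rewrite lerDl divr_ge0 ?sqr_ge0//.
  by apply: sumr_ge0 => u _; exact: sqr_ge0.
have hi : invertible h.
  by apply/invertibleP => y'; apply/eqP => e; have := h1 y'; rewrite e /= ler10.
have hV := binv_invertible hi.
(* As [h(y) = 1 + s] with [M * s <= 1], [M / h(y) >= M - 1]; this forces [|P(x)| >= M - 4] at some
   [x]. *)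
pose M := t^-1; have M0 : 0 < M by rewrite invr_gt0.
have N6 : 64 <= N ^+ 6 by rewrite (_ : 64 = 2 ^+ 6); [rewrite lerXn2r ?nnegrE; lra|ring].
have K2 : 1 <= K ^+ 2 by rewrite expr_ge1// ltW.
have MK : M = 32 * K ^+ 2 * N ^+ 6 by rewrite /M invrK.
have M4 : 4 <= M by rewrite MK; nra.
have tM : t * M = 1 by rewrite mulfV// gt_eqF.
have t1 : t <= 1 by nra.
have iM : invertible (M%:C *: binv h).
  by apply/invertibleP => y'; rewrite gelfandZ mulf_neq0 ?invertible_neq0// eq_complex /= negb_and gt_eqF.
have [P iP TP] := T_surj iM; have iP' := binv_invertible iP.
have [x xP] := T_adherent y iP (@invertible1 R A) ltr01.
have {}xP : M - 4 <= cabs (P$x).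
  have PM : M - 1 <= cabs ((T P)$y).
    rewrite TP gelfandZ gelfand_binv// hy cabsM cabsV !cabs_real !ger0_norm; try lra.
    rewrite ler_pdivlMr; last lra.
    have : M * s <= M * t by rewrite ler_pM2l.
    nra.
  move: xP; rewrite T1 !gelfand1 !mulr1 => xP.
  have := cabsB (P$x) 1; have := cabsD ((T P)$y - 1) 1.
  rewrite subrK cabs1; lra.
exists y, x; split; first by move=> y'; apply: le_trans (hE y') _; rewrite lerD2l.
move=> f z ff zz; have [fi fK] := fsP _ ff.
have z0 := quarter_turns_neq0 zz; have cz := cabs_quarter_turns zz.
have iz := @invertible_scalar R A _ z0; have iz' := binv_invertible iz.
have iE : invertible (N%:C *: (T z%:A * binv h)).
  apply/invertibleP => y'; rewrite gelfandZ mulf_neq0//.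
    by rewrite eq_complex /= negb_and gt_eqF.
  by apply: invertible_neq0; apply: invertibleM => //; exact: T_inv.
have [E Ei TE] := T_surj iE; have Ei' := binv_invertible Ei.
have TEy y' : (T E)$y' = N%:C * ((T z%:A)$y' / h$y').
  by rewrite TE gelfandZ gelfandM gelfand_binv.
have Tz0 y' : (T z%:A)$y' != 0 by apply: invertible_neq0; exact: T_inv.
have h0 y' : h$y' != 0 by exact: invertible_neq0.
have NC0 : N%:C != 0 :> R[i] by rewrite eq_complex /= negb_and gt_eqF.
(* [TE / Tz = N / h] takes its values in the disc [|w - 1| <= N - 1], hence so does [E / z]. *)
have Ez : cabs (E$x / z - 1) <= N - 1.
  have := @T_le E (binv z%:A) (N - 1) Ei iz' _ x; rewrite gelfand_binv// gelfandA; apply.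
  move=> y'; rewrite TEy T_binvE//.
  have -> : N%:C * ((T z%:A)$y' / h$y') / (T z%:A)$y' = N%:C / h$y'.
    by field; rewrite h0 Tz0.
  exact: disc_bound_real.
have PE : cabs (P$x / E$x - 1) <= M / N + 1.
  have := @T_le P (binv E) (M / N + 1) iP Ei' _ x; rewrite gelfand_binv//; apply.
  move=> y'; rewrite T_binvE// TEy TP gelfandZ gelfand_binv//.
  have -> : M%:C / h$y' / (N%:C * ((T z%:A)$y' / h$y')) = M%:C / N%:C / (T z%:A)$y'.
    by field; rewrite h0 Tz0 NC0.
  apply: le_trans (cabsB _ _) _.
  by rewrite cabs1 !cabsM !cabsV T_turn_unit// !cabs_real !ger0_norm ?invr1 ?mulr1// ltW.
have cE0 : 0 < cabs (E$x) by apply: cabs_gt0; exact: invertible_neq0.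
have cPE : cabs (P$x) <= (M / N + 2) * cabs (E$x).
  rewrite -ler_pdivrMr// -cabsV -cabsM.
  have := cabsD (P$x / E$x - 1) 1; rewrite subrK cabs1; lra.
have Elow : N - 4 * N ^+ 2 * t <= cabs (E$x / z).
  rewrite cabsM cabsV cz invr1 mulr1.
  have k1 : N * (M - 4) <= (M + 2 * N) * cabs (E$x).
    have -> : (M + 2 * N) * cabs (E$x) = N * ((M / N + 2) * cabs (E$x)).
      by field; rewrite gt_eqF.
    by rewrite ler_pM2l//; exact: le_trans cPE.
  have k2 : (M + 2 * N) * (N - 4 * N ^+ 2 * t) <= N * (M - 4).
    have -> : (M + 2 * N) * (N - 4 * N ^+ 2 * t) =
      M * N + 2 * N ^+ 2 - 4 * N ^+ 2 * (t * M) - 8 * (N ^+ 3 * t) by ring.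
    have : 0 <= N ^+ 3 * t by rewrite mulr_ge0 ?exprn_ge0// ltW.
    rewrite tM; nra.
  rewrite -(@ler_pM2l _ (M + 2 * N)); first exact: le_trans k1.
  lra.
have N6E : N ^+ 6 = N ^+ 2 * N ^+ 4 by rewrite -exprD.
have tN : 8 * N ^+ 4 * t <= (2 * K * N)^-1 ^+ 2.
  rewrite /t exprVn -[leLHS]/(_ / _) ler_pdivrMr; last by rewrite !mulr_gt0// exprn_gt0.
  rewrite [leRHS]mulrC ler_pdivlMr; last by rewrite exprn_gt0// !mulr_gt0.
  by rewrite !exprMn N6E le_eqVlt; apply/orP; left; apply/eqP; ring.
have tN2 : N * t <= (2 * N)^-1.
  rewrite /t -[leLHS]/(_ / _) ler_pdivrMr; last by rewrite !mulr_gt0// exprn_gt0.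
  rewrite [leRHS]mulrC ler_pdivlMr ?mulr_gt0// N6E.
  have : N ^+ 2 * 4 <= N ^+ 2 * N ^+ 4.
    rewrite ler_pM2l ?exprn_gt0// (_ : N ^+ 4 = N ^+ 2 * N ^+ 2) -?exprD//; nra.
  nra.
have Etip : cabs (E$x / z - N%:C) <= (2 * K * N)^-1.
  have d0 : 0 <= 4 * N ^+ 2 * t <= N.
    rewrite !mulr_ge0 ?exprn_ge0 ?(ltW t0) ?(ltW N0)//=.
    have : 8 * N * (N * t) <= 8 * N * (2 * N)^-1 by rewrite ler_pM2l// mulr_gt0.
    have -> : 8 * N * (2 * N)^-1 = 4 by field; rewrite gt_eqF.
    nra.
  have N1 : 1 <= N by lra.
  have tip := near_disc_tip N1 d0 Ez Elow.
  rewrite -ler_sqr ?nnegrE ?cabs_ge0 ?invr_ge0 ?mulr_ge0 ?(ltW K0) ?(ltW N0)//.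
  apply: le_trans tip _; apply: le_trans tN.
  by rewrite le_eqVlt; apply/orP; left; apply/eqP; ring.
pose V := T f * T z%:A.
have VD : V \in D :: turned fs.
  by rewrite inE; apply/orP; right; apply/allpairsP; exists (f, z).
(* Freezing [V] at its value at [y] leaves an expression bounded by [disc_bound]. The error is at
   most [N * t]: with [v = |V(y') - V(y)|], [|h(y')| >= 1 + v ^+ 2 / t ^+ 2] gives
   [t * |h(y')| >= t + v ^+ 2 / t >= v]. *)
have fE : cabs (f$x * E$x - 1) <= N * cabs ((T f)$y) / 2 +
    cabs (N%:C * ((T f)$y * (T z%:A)$y) * (2^-1)%:C - 1) + N * t.
  apply: T_le => // y'.
  have -> : (T f)$y' * (T E)$y' - 1 = (N%:C * V$y / h$y' - 1) + N%:C * ((V$y' - V$y) / h$y').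
    by rewrite TEy !gelfandM; ring.
  apply: le_trans (cabsD _ _) _; apply: lerD.
    apply: le_trans (disc_bound _ (h1 y')) _.
    rewrite gelfandM lerD2r !cabsM T_turn_unit// mulr1 cabs_real ger0_norm//.
    exact: ltW.
  rewrite cabsM cabs_real ger0_norm ?(ltW N0)// ler_pM2l// cabsM cabsV.
  rewrite ler_pdivrMr ?cabs_gt0//.
  set v := cabs (V$y' - V$y).
  have vg : v ^+ 2 <= gap (D :: turned fs) y y'.
    rewrite /gap (big_rem V)//= lerDl; apply: sumr_ge0 => u _; exact: sqr_ge0.
  have vh : 1 + v ^+ 2 / t ^+ 2 <= cabs (h$y').
    apply: le_trans (Re_le_cabs _); apply: le_trans (hgap y').
    by rewrite lerD2l ler_pM2r// invr_gt0 exprn_gt0.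
  have : t * (1 + v ^+ 2 / t ^+ 2) <= t * cabs (h$y') by rewrite ler_pM2l.
  apply: le_trans; have -> : t * (1 + v ^+ 2 / t ^+ 2) = (t ^+ 2 + v ^+ 2) / t.
    by field; rewrite gt_eqF.
  rewrite ler_pdivlMr//; have := sqr_ge0 (t - v); have := cabs_ge0 (V$y' - V$y).
  rewrite -/v; nra.
(* Replacing [E(x)] by [z N] costs at most [K * (2 * K * N)^-1], the second half of [N^-1]. *)
have -> : N%:C * (z * f$x) - 1 = (f$x * E$x - 1) - f$x * (z * (E$x / z - N%:C)).
  by field.
apply: le_trans (cabsB _ _) _.
rewrite !cabsM cz mul1r.
have fx : cabs (f$x) * cabs (E$x / z - N%:C) <= K * (2 * K * N)^-1.
  apply: ler_pM; rewrite ?cabs_ge0//; exact: le_trans (gelfand_le_nrm _ _) _.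
have -> : N^-1 = (2 * N)^-1 + K * (2 * K * N)^-1 by field; rewrite !gt_eqF.
move: fE fx tN2; lra.
Qed.

End Preserver.

(** * From the disc inequalities to the values of [T] *)

Section Asymptotics.
Context {R : realType}.
Implicit Types (z : R[i]) (xi tau : cplx R) (K N : R).

Lemma real_neq0 (r : R) : 0 < r -> r%:C != 0 :> cplx R.
Proof. by move=> r0; rewrite eq_complex /= negb_and gt_eqF. Qed.

Lemma turn_ineq z xi tau N : 0 < N -> cabs z = 1 -> xi != 0 -> tau != 0 ->
  cabs (N%:C * (z * xi) - 1) <=
    N * cabs tau / 2 + cabs (N%:C * (z * tau) * (2^-1)%:C - 1) + N^-1 ->
  N * cabs xi - complex.Re (z * xi) / cabs xi <=
    N * cabs tau - complex.Re (z * tau) / cabs tau + (N * cabs tau)^-1 + N^-1.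
Proof.
move=> N0 cz xi0 tau0.
have z0 : z != 0 by apply/eqP => e; move: cz; rewrite e cabs0 => /esym/eqP; rewrite oner_eq0.
have Xi := cabs_gt0 xi0; have Ta := cabs_gt0 tau0.
have ReZ (r : R) (w : cplx R) : complex.Re (r%:C * w) = r * complex.Re w.
  by case: w => a b /=; ring.
have w1 : N%:C * (z * xi) != 0 by rewrite !mulf_neq0// real_neq0.
have w2 : N%:C * (z * tau) * (2^-1)%:C != 0.
  by rewrite !mulf_neq0// real_neq0// invr_gt0.
have h1 := le_cabs_sub1 w1; have h2 := cabs_sub1_le w2.
have e2 : N%:C * (z * tau) * (2^-1)%:C = (N / 2)%:C * (z * tau).
  by rewrite rmorphM /=; ring.
have c1 : cabs (N%:C * (z * xi)) = N * cabs xi.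
  by rewrite !cabsM cz mul1r cabs_real ger0_norm// ltW.
have c2 : cabs (N%:C * (z * tau) * (2^-1)%:C) = N * cabs tau / 2.
  by rewrite !cabsM cz mul1r !cabs_real !ger0_norm ?invr_ge0// ltW.
rewrite c1 ReZ in h1; rewrite c2 {2}e2 ReZ in h2.
have e3 : N * complex.Re (z * xi) / (N * cabs xi) = complex.Re (z * xi) / cabs xi.
  by field; rewrite !gt_eqF.
have e4 : N / 2 * complex.Re (z * tau) / (N * cabs tau / 2) = complex.Re (z * tau) / cabs tau.
  by field; rewrite !gt_eqF.
have e5 : (2 * (N * cabs tau / 2))^-1 = (N * cabs tau)^-1 by congr (_^-1); field.
rewrite e3 in h1; rewrite e4 e5 in h2; lra.
Qed.

(** Adding the inequalities for [z] and [-z] cancels the directions and gives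
    [|xi| - |tau| <= C / N]; the same for the inverses bounds [|tau| - |xi|]. Once moduli are
    compared, the four values of [z] bound both coordinates of the difference of directions. *)
Lemma near_equal K N xi tau : 1 <= K -> 2 <= N -> xi != 0 -> tau != 0 ->
  cabs xi <= K -> cabs (xi^-1) <= K -> cabs tau <= K -> cabs (tau^-1) <= K ->
  (forall z, z \in quarter_turns ->
    cabs (N%:C * (z * xi) - 1) <=
      N * cabs tau / 2 + cabs (N%:C * (z * tau) * (2^-1)%:C - 1) + N^-1 /\
    cabs (N%:C * (z * xi^-1) - 1) <=
      N * cabs (tau^-1) / 2 + cabs (N%:C * (z * tau^-1) * (2^-1)%:C - 1) + N^-1) ->
  cabs (xi - tau) <= 6 * K ^+ 3 / N.
Proof.
move=> K1 N2 xi0 tau0 xK xVK tK tVK hz.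
have N0 : 0 < N by lra.
have X0 := cabs_gt0 xi0; have Y0 := cabs_gt0 tau0.
pose C := (1 + K) / N.
have C0 : 0 <= C by rewrite divr_ge0; lra.
have small (r : R) : 0 < r -> r^-1 <= K -> (N * r)^-1 + N^-1 <= C.
  by move=> r0 rK; rewrite invfM /C mulrC -[X in _ + X]mul1r -mulrDl ler_pM2r ?invr_gt0//; lra.
have k1 z : z \in quarter_turns ->
    N * (cabs xi - cabs tau) <= complex.Re (z * xi) / cabs xi - complex.Re (z * tau) / cabs tau + C.
  move=> zz; have [/(turn_ineq N0 (cabs_quarter_turns zz) xi0 tau0) h _] := hz z zz.
  by have s := small _ Y0; rewrite -cabsV in s; have := s tVK; lra.
have k2 z : z \in quarter_turns ->
    N * (cabs xi^-1 - cabs tau^-1) <=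
      complex.Re (z * xi^-1) / cabs xi^-1 - complex.Re (z * tau^-1) / cabs tau^-1 + C.
  move=> zz; have xi0' : xi^-1 != 0 by rewrite invr_eq0.
  have tau0' : tau^-1 != 0 by rewrite invr_eq0.
  have [_ /(turn_ineq N0 (cabs_quarter_turns zz) xi0' tau0') h] := hz z zz.
  by have s := small _ (cabs_gt0 tau0'); rewrite -[X in X <= K]cabsV invrK in s; have := s tK; lra.
have z1 : (1 : R[i]) \in quarter_turns by rewrite !inE eqxx.
have z2 : (-1 : R[i]) \in quarter_turns by rewrite !inE eqxx orbT.
have z3 : ('i%C : R[i]) \in quarter_turns by rewrite !inE eqxx !orbT.
have z4 : (- 'i%C : R[i]) \in quarter_turns by rewrite !inE eqxx !orbT.
have conjV (w : cplx R) : w != 0 -> complex.Re (w^-1) / cabs w^-1 = complex.Re w / cabs w /\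
    complex.Re ('i%C * w^-1) / cabs w^-1 = complex.Im w / cabs w.
  move=> w0; have c0 := cabs_gt0 w0; have n0 : cabs w != 0 by rewrite gt_eqF.
  have sq := sqr_cabs w; rewrite cabsV; move: (cabs w) n0 sq => r {c0 w0}.
  by case: w => a b n0 /= sq; split; rewrite -sq; field.
have ReN (w : cplx R) : complex.Re (-1 * w) = - complex.Re w by case: w => a b /=; ring.
have ReI (w : cplx R) : complex.Re ('i%C * w) = - complex.Im w by case: w => a b /=; ring.
have ReNIV (w : cplx R) : complex.Re (- 'i%C * w) = - complex.Re ('i%C * w).
  by case: w => a b /=; ring.
have [xV1 xV2] := conjV xi xi0; have [tV1 tV2] := conjV tau tau0.
have := k1 _ z1; have := k1 _ z2; have := k1 _ z3; have := k1 _ z4.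
have := k2 _ z1; have := k2 _ z2; have := k2 _ z3; have := k2 _ z4.
rewrite !mul1r !ReN !ReNIV !mulNr xV1 xV2 tV1 tV2 !ReI !cabsV !mulNr !opprK.
move=> g1 g2 g3 g4 g5 g6 g7 g8.
have xE : xi = (cabs xi)%:C * (complex.Re xi / cabs xi +i* (complex.Im xi / cabs xi)).
  have n0 : cabs xi != 0 by rewrite gt_eqF.
  by case: (xi) n0 => a b /= n0; apply/eqP; rewrite eq_complex /=; apply/andP; split; apply/eqP; field.
have tE : tau = (cabs tau)%:C * (complex.Re tau / cabs tau +i* (complex.Im tau / cabs tau)).
  have n0 : cabs tau != 0 by rewrite gt_eqF.
  by case: (tau) n0 => a b /= n0; apply/eqP; rewrite eq_complex /=; apply/andP; split; apply/eqP; field.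
have cp : cabs (complex.Re xi / cabs xi +i* (complex.Im xi / cabs xi) : cplx R) = 1.
  have := congr1 cabs xE; rewrite cabsM cabs_real ger0_norm ?cabs_ge0// => e.
  by apply: (mulfI (_ : cabs xi != 0)); rewrite ?gt_eqF// -e mulr1.
rewrite xE tE; rewrite !cabsV in xVK tVK.
move: X0 Y0 xK tK xVK tVK cp g1 g2 g3 g4 g5 g6 g7 g8.
clear -K1 N2 N0 C0 C.
move: (cabs xi) (cabs tau) (complex.Re xi / _) (complex.Im xi / _) (complex.Re tau / _) (complex.Im tau / _).
move=> X Y a b c d X0 Y0 xK tK xVK tVK cp g1 g2 g3 g4 g5 g6 g7 g8.
have K0 : 0 < K by lra.
have KK : 1 <= K ^+ 2 by rewrite expr_ge1// ltW.
have d1 : X - Y <= C / N by rewrite ler_pdivlMr// mulrC; lra.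
have d2 : Y - X <= K ^+ 2 * (C / N).
  have h : X^-1 - Y^-1 <= C / N by rewrite ler_pdivlMr// mulrC; lra.
  have -> : Y - X = X * Y * (X^-1 - Y^-1) by field; rewrite !gt_eqF.
  apply: (@le_trans _ _ (X * Y * (C / N))); first by rewrite ler_pM2l// mulr_gt0.
  apply: ler_wpM2r; first by rewrite divr_ge0// ltW.
  by rewrite expr2 ler_pM// ltW.
have CN : C / N <= C by rewrite ler_pdivrMr// ler_peMr//; lra.
have CN0 : 0 <= C / N by rewrite divr_ge0// ltW.
have d3 : `|X - Y| <= K ^+ 2 * C.
  have h : K ^+ 2 * (C / N) <= K ^+ 2 * C by rewrite ler_wpM2l ?sqr_ge0.
  by rewrite ler_norml; apply/andP; split; nra.
(* If [|tau| <= |xi|], the inequalities for [xi] have a nonnegative left-hand side and bound the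
   directions; otherwise those for [xi^-1] do. *)
have [d4 d5] : `|a - c| <= C /\ `|b - d| <= C.
  have [XY|/ltW XY] := leP Y X.
    have h : 0 <= N * (X - Y) by rewrite mulr_ge0 ?subr_ge0// ltW.
    by rewrite !ler_norml; split; apply/andP; split; lra.
  have h : 0 <= N * (X^-1 - Y^-1) by rewrite mulr_ge0 ?subr_ge0 ?lef_pV2// ltW.
  by rewrite !ler_norml; split; apply/andP; split; lra.
have -> : X%:C * (a +i* b) - Y%:C * (c +i* d) =
    (X - Y)%:C * (a +i* b) + Y%:C * ((a - c)%:C + 'i%C * (b - d)%:C).
  by apply/eqP; rewrite eq_complex /=; apply/andP; split; apply/eqP; ring.
apply: le_trans (cabsD _ _) _; rewrite !cabsM cp mulr1 !cabs_real (ger0_norm (ltW Y0)).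
have d6 : cabs ((a - c)%:C + 'i%C * (b - d)%:C : cplx R) <= 2 * C.
  by apply: le_trans (cabsD _ _) _; rewrite cabsM cabs_i mul1r !cabs_real; lra.
have d7 : Y * cabs ((a - c)%:C + 'i%C * (b - d)%:C : cplx R) <= K * (2 * C).
  by rewrite ler_pM// ?cabs_ge0// ltW.
have -> : 6 * K ^+ 3 / N = 3 * K ^+ 2 * (2 * K / N) by rewrite exprS; ring.
have CK : C <= 2 * K / N by rewrite /C ler_pM2r ?invr_gt0//; lra.
have : 3 * K ^+ 2 * C <= 3 * K ^+ 2 * (2 * K / N) by rewrite ler_pM2l//; nra.
have : K * C <= K ^+ 2 * C by rewrite ler_wpM2r// expr2 ler_peMl// ltW.
lra.
Qed.

End Asymptotics.

Definition conj_unless {R : realType} (s : bool) (w : cplx R) : cplx R := if s then w else w^*.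

Section Transfer.
Context {R : realType} {A B : comBanachAlgType R} (T : A -> B).
Hypothesis ssB : @semisimple R B.
Hypothesis T_preserver : radius_preserver T.
Implicit Types (f g : A) (x : max_ideal_space A) (y : max_ideal_space B).

Lemma T_turn y : exists s, forall z, z \in quarter_turns ->
  (T z%:A)$y = conj_unless s z.
Proof.
have [_ _ T1 _] := T_preserver.
have [h|h] := T_i_unit ssB T_preserver y; [exists true|exists false] => z;
  rewrite !inE => /or4P[] /eqP ->; rewrite ?scale1r ?scaleN1r ?T1 ?T_neg1// ?gelfandN ?gelfand1//
  ?T_turnNi// ?h// /conj_unless ?rmorphN ?rmorph1//; by apply/eqP; rewrite eq_complex /= ?oppr0 ?opprK !eqxx.
Qed.

(* Giving [D] a large weight in the energy keeps [D] away from [0] at the peak. *)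
Lemma transfer (fs : seq A) (D : B) : (forall f, f \in fs -> invertible f) -> D != 0 ->
  exists2 d : R, 0 < d & forall e : R, 0 < e -> exists y x s,
    d <= cabs (D$y) /\
    forall f, f \in fs -> cabs (conj_unless s (f$x) - (T f)$y) <= e.
Proof.
move=> fsi D0; have [T_inv _ _ _] := T_preserver.
have [y0 Dy0] : exists y0, D$y0 != 0.
  apply: contrapT => /forallNP n; move/eqP: D0; apply.
  apply: (gelfand_inj ssB) => y; rewrite gelfand0; apply/eqP/negPn/negP; exact: n.
(* Inverses are added because [near_equal] needs the estimate for [f(x)] and for its inverse at the
   same points. *)
pose fs' := fs ++ map binv fs.
pose K : R := 1 + \sum_(f <- fs') (nrm f + nrm (T f)).
pose C : R := \sum_(u <- turned T fs') nrm u ^+ 2.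
have C0 : 0 <= C by apply: sumr_ge0 => u _; exact: sqr_ge0.
have fK f : f \in fs' -> nrm f <= K /\ nrm (T f) <= K.
  move=> ff; rewrite /K (big_rem f)//=.
  have := nrm_ge0 f; have := nrm_ge0 (T f).
  have : 0 <= \sum_(g <- rem f fs') (nrm g + nrm (T g)).
    by apply: sumr_ge0 => g _; rewrite addr_ge0 ?nrm_ge0.
  by split; lra.
have K1 : 1 <= K.
  by rewrite lerDl; apply: sumr_ge0 => g _; rewrite addr_ge0 ?nrm_ge0.
have fi f : f \in fs' -> invertible f.
  by rewrite mem_cat => /orP[/fsi//|/mapP[g /fsi gi ->]]; exact: binv_invertible.
pose d0 := cabs (D$y0); have d00 : 0 < d0 by exact: cabs_gt0.
exists (d0 / 2); first by rewrite divr_gt0.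
move=> e e0; pose N := 2 + 6 * K ^+ 3 / e.
have K3 : 0 < 6 * K ^+ 3 by rewrite mulr_gt0// exprn_gt0//; lra.
have N2 : 2 <= N by rewrite lerDl divr_ge0// ltW.
have N0 : 0 < N by lra.
(* The other terms of the energy total at most [C], so near-maximality gives [L ^+ 2 * |D(y)| ^+ 2
   >= L ^+ 2 * d0 ^+ 2 - C - 1]; since [L ^+ 2 * d0 ^+ 2 = 4 * (C + 2) ^+ 2], this implies
   [|D(y)| >= d0 / 2]. *)
have [L L0 Ld0] : exists2 L, 0 < L & L * d0 = 2 * (C + 2).
  by exists (2 * (C + 2) / d0); [rewrite divr_gt0//; lra|rewrite divfK// gt_eqF].
have [|y [x [hE hst]]] := nearly_exposed_pair ssB T_preserver (L%:C *: D) K1 N2 (fs := fs').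
  by move=> f ff; split; [exact: fi|case: (fK f ff)].
have [s hs] := T_turn y; exists y, x, s; split.
  have := hE y0; rewrite /energy !big_cons -!/(energy _ _) !gelfandZ !cabsM.
  rewrite cabs_real ger0_norm ?(ltW L0)// -/d0 !exprMn => h.
  have h2 : energy (turned T fs') y <= C := energy_le _ _.
  have h3 : 0 <= energy (turned T fs') y0 by apply: sumr_ge0 => u _; exact: sqr_ge0.
  have Ld : L ^+ 2 * d0 ^+ 2 = (2 * (C + 2)) ^+ 2.
    by rewrite -exprMn Ld0.
  have L2 : 0 < L ^+ 2 by rewrite exprn_gt0.
  have key : L ^+ 2 * (d0 / 2) ^+ 2 <= L ^+ 2 * cabs (D$y) ^+ 2.
    have -> : L ^+ 2 * (d0 / 2) ^+ 2 = L ^+ 2 * d0 ^+ 2 / 4 by field.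
    have c3 : C + 1 <= 3 * (C + 2) ^+ 2 by nra.
    by rewrite Ld; rewrite Ld in h; lra.
  rewrite -ler_sqr ?nnegrE ?cabs_ge0//; last by rewrite divr_ge0// ltW.
  by rewrite -(ler_pM2l L2).
move=> f ff; have ff' : f \in fs' by rewrite mem_cat ff.
have fV' : binv f \in fs' by rewrite mem_cat map_f ?orbT.
have i := fsi f ff.
have NK : 6 * K ^+ 3 / N <= e.
  have eK : e * (6 * K ^+ 3 / e) = 6 * K ^+ 3 by field; rewrite gt_eqF.
  by rewrite ler_pdivrMr// /N mulrDr eK; lra.
apply: le_trans NK; have [k1 k2] := fK f ff'; have [k3 k4] := fK _ fV'.
have cc (w : cplx R) : cabs (conj_unless s w) = cabs w by case: s {hs} => //=; exact: cabs_conj.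
have cV (w : cplx R) : conj_unless s (w^-1) = (conj_unless s w)^-1.
  by case: s {hs cc} => //=; exact: conjc_inv.
have xi0 : conj_unless s (f$x) != 0.
  have := invertible_neq0 x i; case: s {hs cc cV} => //=.
  by rewrite conjc_eq0.
apply: near_equal => //.
- by apply: invertible_neq0; exact: T_inv.
- by rewrite cc; apply: le_trans (gelfand_le_nrm _ _) _.
- by rewrite -cV cc -gelfand_binv//; apply: le_trans (gelfand_le_nrm _ _) _.
- by apply: le_trans (gelfand_le_nrm _ _) _.
- by rewrite -(T_binvE T_preserver)//; apply: le_trans (gelfand_le_nrm _ _) _.
move=> z zz; have z'z : (conj_unless s z : R[i]) \in quarter_turns.
  case: s {hs cc cV xi0} => //=; move: zz; rewrite !inE => /or4P[] /eqP ->;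
  by rewrite !eq_complex /= ?oppr0 ?opprK !eqxx ?orbT.
have cinv : conj_unless s (conj_unless s z) = z by case: s {hs cc cV xi0 z'z} => //=; exact: conjcK.
(* The estimate is taken at the turn [conj_unless s z], whose image under [T] has the value [z] at
   [y]; conjugating inside the modulus on the left then turns [g(x)] into [conj_unless s] of it. *)
have star g : g \in fs' -> cabs (N%:C * (z * conj_unless s (g$x)) - 1) <=
    N * cabs ((T g)$y) / 2 + cabs (N%:C * (z * (T g)$y) * (2^-1)%:C - 1) + N^-1.
  move=> gg; have := hst g _ gg z'z; rewrite hs// cinv (mulrC _ z).
  congr (_ <= _); rewrite -cc; congr cabs.
  case: s {hs cc cV xi0 z'z cinv hst} => //=.
  case: z {zz} => a b; case: (g$x) => c d /=.
  by apply/eqP; rewrite eq_complex /=; apply/andP; split; apply/eqP; ring.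
split; first exact: star.
by have := star _ fV'; rewrite gelfand_binv// cV T_binvE.
Qed.

End Transfer.
(** * The real-algebra isomorphism *)

Section Extension.
Context {R : realType} {A B : comBanachAlgType R} (T : A -> B).
Hypothesis ssA : @semisimple R A.
Hypothesis ssB : @semisimple R B.
Hypothesis T_preserver : radius_preserver T.
Implicit Types (f g a b : A) (x : max_ideal_space A) (y : max_ideal_space B).

(** The device behind all identities: [transfer] provides points with [|D(y)| >= d] for a [d]
    independent of [e], which is incompatible with [|D(y)| <= c * e] for small [e]. *)
Lemma T_approx (fs : seq A) (D : B) (c : R) : 0 <= c ->
  (forall f, f \in fs -> invertible f) ->
  (forall e y x s, 0 < e ->
    (forall f, f \in fs -> cabs (conj_unless s (f$x) - (T f)$y) <= e) ->
    cabs (D$y) <= c * e) -> D = 0.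
Proof.
move=> c0 fsi h; apply: contrapT => /eqP D0.
have [d d0 /(_ (d / (2 * (c + 1))))] := transfer ssB T_preserver fsi D0.
have c1 : 0 < 2 * (c + 1) by lra.
have e0 : 0 < d / (2 * (c + 1)) by rewrite divr_gt0.
move=> /(_ e0)[y [x [s [dD fx]]]].
have := h _ y x s e0 fx; have : c * (d / (2 * (c + 1))) <= d / 2.
  have -> : d / 2 = (c + 1) * (d / (2 * (c + 1))) by field; rewrite gt_eqF//; lra.
  by rewrite ler_pM2r//; lra.
lra.
Qed.

Lemma conj_unlessD s (z w : cplx R) :
  conj_unless s (z + w) = conj_unless s z + conj_unless s w.
Proof. by case: s => //; rewrite /conj_unless rmorphD. Qed.

Lemma conj_unlessM s (z w : cplx R) :
  conj_unless s (z * w) = conj_unless s z * conj_unless s w.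
Proof. by case: s => //; rewrite /conj_unless rmorphM. Qed.

Lemma conj_unless_real s (r : R) : conj_unless s r%:C = r%:C.
Proof. by case: s => //; exact: conjc_real. Qed.

Lemma cabs_conj_unless s (z : cplx R) : cabs (conj_unless s z) = cabs z.
Proof. by case: s => //; exact: cabs_conj. Qed.

Lemma T_add f g : invertible f -> invertible g -> invertible (f + g) ->
  T (f + g) = T f + T g.
Proof.
move=> fi gi fgi; apply/eqP; rewrite -subr_eq0; apply/eqP.
apply: (@T_approx [:: f + g; f; g] _ 3) => //.
  by move=> h; rewrite !inE => /or3P[] /eqP ->.
move=> e y x s e0 fx.
have h1 := fx _ (mem_head _ _).
have h2 : cabs (conj_unless s (f$x) - (T f)$y) <= e by apply: fx; rewrite !inE eqxx orbT.
have h3 : cabs (conj_unless s (g$x) - (T g)$y) <= e by apply: fx; rewrite !inE eqxx !orbT.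
have -> : (T (f + g) - (T f + T g))$y =
    (conj_unless s (f$x) - (T f)$y) + (conj_unless s (g$x) - (T g)$y)
    - (conj_unless s ((f + g)$x) - (T (f + g))$y).
  by rewrite gelfandB gelfandD (gelfandD f) conj_unlessD; ring.
apply: le_trans (cabsB _ _) _.
have := cabsD (conj_unless s (f$x) - (T f)$y) (conj_unless s (g$x) - (T g)$y); lra.
Qed.

Lemma T_mul f g : invertible f -> invertible g -> T (f * g) = T f * T g.
Proof.
move=> fi gi; apply/eqP; rewrite -subr_eq0; apply/eqP.
apply: (@T_approx [:: f * g; f; g] _ (1 + nrm f + nrm (T g))) => //.
- by rewrite !addr_ge0 ?nrm_ge0.
- by move=> h; rewrite !inE => /or3P[] /eqP -> //; exact: invertibleM.
move=> e y x s e0 fx.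
have h1 := fx _ (mem_head _ _).
have h2 : cabs (conj_unless s (f$x) - (T f)$y) <= e by apply: fx; rewrite !inE eqxx orbT.
have h3 : cabs (conj_unless s (g$x) - (T g)$y) <= e by apply: fx; rewrite !inE eqxx !orbT.
have -> : (T (f * g) - T f * T g)$y =
    conj_unless s (f$x) * (conj_unless s (g$x) - (T g)$y) +
    (T g)$y * (conj_unless s (f$x) - (T f)$y)
    - (conj_unless s ((f * g)$x) - (T (f * g))$y).
  by rewrite gelfandB gelfandM (gelfandM f) conj_unlessM; ring.
apply: le_trans (cabsB _ _) _.
have k1 : cabs (conj_unless s (f$x) * (conj_unless s (g$x) - (T g)$y)) <= nrm f * e.
  by rewrite cabsM cabs_conj_unless ler_pM ?cabs_ge0// gelfand_le_nrm.
have k2 : cabs ((T g)$y * (conj_unless s (f$x) - (T f)$y)) <= nrm (T g) * e.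
  by rewrite cabsM ler_pM ?cabs_ge0// gelfand_le_nrm.
by have := cabsD (conj_unless s (f$x) * (conj_unless s (g$x) - (T g)$y))
  ((T g)$y * (conj_unless s (f$x) - (T f)$y)); lra.
Qed.

Lemma T_real (r : R) f : r != 0 -> invertible f -> T (r%:C *: f) = r%:C *: T f.
Proof.
move=> r0 fi; apply/eqP; rewrite -subr_eq0; apply/eqP.
apply: (@T_approx [:: r%:C *: f; f] _ (1 + `|r|)) => //.
- move=> h; rewrite !inE => /orP[] /eqP -> //; apply/invertibleP => x.
  by rewrite gelfandZ mulf_neq0 ?invertible_neq0// eq_complex /= negb_and r0.
move=> e y x s e0 fx.
have h1 := fx _ (mem_head _ _).
have h2 : cabs (conj_unless s (f$x) - (T f)$y) <= e by apply: fx; rewrite !inE eqxx orbT.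
have -> : (T (r%:C *: f) - r%:C *: T f)$y =
    r%:C * (conj_unless s (f$x) - (T f)$y)
    - (conj_unless s ((r%:C *: f)$x) - (T (r%:C *: f))$y).
  by rewrite gelfandB gelfandZ (gelfandZ _ f) conj_unlessM conj_unless_real; ring.
apply: le_trans (cabsB _ _) _; rewrite cabsM cabs_real mulrDl mul1r addrC lerD//.
by rewrite ler_wpM2l.
Qed.

Lemma shift_invertible (C : comBanachAlgType R) (a : C) (r : R) : nrm a < r ->
  invertible (a + r%:C%:A).
Proof.
move=> ar; apply/invertibleP => x; rewrite gelfandD gelfandA; apply/eqP => /eqP.
rewrite addr_eq0 => /eqP e; have := gelfand_le_nrm a x.
by rewrite e cabsN cabs_real leNgt (lt_le_trans ar (ler_norm r)).
Qed.

Lemma real_invertible (C : comBanachAlgType R) (r : R) : r != 0 ->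
  invertible (r%:C%:A : C).
Proof. by move=> r0; apply: invertible_scalar; rewrite eq_complex /= negb_and r0. Qed.

Lemma real_scalarM (C : comBanachAlgType R) (u v : R) :
  (u * v)%:C%:A = u%:C%:A * v%:C%:A :> C.
Proof. by rewrite -scaleAE scalerA -rmorphM. Qed.

Lemma T_scalar (r : R) : r != 0 -> T r%:C%:A = r%:C%:A.
Proof.
have [_ _ T1 _] := T_preserver.
by move=> r0; rewrite T_real ?T1//; exact: invertible1.
Qed.

Definition T_ext a : B := T (a + (nrm a + 1)%:C%:A) - (nrm a + 1)%:C%:A.

(** Two shifts are compared through a common larger one [v], for which [a + v] is invertible, by
    additivity of [T] on [a + u] and the scalar [v - u]. *)
Lemma T_extE a (r : R) : invertible (a + r%:C%:A) ->
  T_ext a = T (a + r%:C%:A) - r%:C%:A.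
Proof.
have key (u v : R) : u < v -> nrm a < v -> invertible (a + u%:C%:A) ->
    T (a + u%:C%:A) - u%:C%:A = T (a + v%:C%:A) - v%:C%:A.
  move=> uv av ui; have vu : v - u != 0 by rewrite subr_eq0 gt_eqF.
  have e : a + v%:C%:A = (a + u%:C%:A) + (v - u)%:C%:A.
    by rewrite -addrA -scalerDl -rmorphD /= (addrC u) subrK.
  have wi := @real_invertible A _ vu.
  have vi : invertible (a + u%:C%:A + (v - u)%:C%:A) by rewrite -e; exact: shift_invertible.
  by rewrite e (T_add ui wi vi) T_scalar// rmorphB scalerBl; ring.
move=> ri; have a1 : nrm a < nrm a + 1 by rewrite ltrDl.
pose v := Num.max r (nrm a + 1) + 1.
have rv : r < v by rewrite /v ltr_pwDr// le_max lexx.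
have av : nrm a + 1 < v by rewrite /v ltr_pwDr// le_max lexx orbT.
have nv : nrm a < v by apply: lt_trans av.
by rewrite /T_ext (key r v)// (key (nrm a + 1) v)//; exact: shift_invertible.
Qed.

Lemma T_ext_invertible f : invertible f -> T_ext f = T f.
Proof.
by move=> fi; rewrite (@T_extE _ 0) !scale0r ?addr0 ?subr0.
Qed.

Lemma T_ext_shift a : exists2 r : R, nrm a < r & T_ext a = T (a + r%:C%:A) - r%:C%:A.
Proof. by exists (nrm a + 1); rewrite ?ltrDl. Qed.

Lemma T_ext_scalar (r : R) : T_ext r%:C%:A = r%:C%:A.
Proof.
have [->|r0] := eqVneq r 0; last by rewrite T_ext_invertible ?T_scalar//; exact: real_invertible.
have [_ _ T1 _] := T_preserver.
by rewrite (@T_extE _ 1) ?scale0r ?add0r ?scale1r ?T1 ?subrr//; exact: invertible1.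
Qed.

Lemma T_extD a b : T_ext (a + b) = T_ext a + T_ext b.
Proof.
have ab : nrm (a + b) < (nrm a + 1) + (nrm b + 1).
  by have := nrmD a b; lra.
have e : (a + b) + ((nrm a + 1) + (nrm b + 1))%:C%:A =
    (a + (nrm a + 1)%:C%:A) + (b + (nrm b + 1)%:C%:A).
  by rewrite rmorphD /= scalerDl; ring.
have abi := shift_invertible ab.
have ai : invertible (a + (nrm a + 1)%:C%:A) by apply: shift_invertible; rewrite ltrDl.
have bi : invertible (b + (nrm b + 1)%:C%:A) by apply: shift_invertible; rewrite ltrDl.
have abi' := abi; rewrite e in abi'.
rewrite (T_extE abi) e (T_add ai bi abi') /T_ext.
by move: (nrm a + 1) (nrm b + 1) => u v; rewrite rmorphD /= scalerDl; ring.
Qed.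

Lemma T_extZ (r : R) a : T_ext (r%:C *: a) = r%:C *: T_ext a.
Proof.
have [->|r0] := eqVneq r 0.
  by have := T_ext_scalar 0; rewrite !scale0r.
have ai : invertible (a + (nrm a + 1)%:C%:A) by apply: shift_invertible; rewrite ltrDl.
have e : r%:C *: a + (r * (nrm a + 1))%:C%:A = r%:C *: (a + (nrm a + 1)%:C%:A).
  by rewrite scalerDr scalerA -rmorphM.
rewrite (@T_extE _ (r * (nrm a + 1))) e.
  by rewrite T_real// scalerBr scalerA -rmorphM.
apply/invertibleP => x.
by rewrite gelfandZ mulf_neq0 ?invertible_neq0// eq_complex /= negb_and r0.
Qed.

(** Multiplicativity holds for the invertible shifts [a + u] and [b + v]; expanding both sides and
    cancelling the real-linear terms leaves the claim. *)
Lemma T_extM a b : T_ext (a * b) = T_ext a * T_ext b.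
Proof.
set u := nrm a + 1; set v := nrm b + 1.
have ai : invertible (a + u%:C%:A) by apply: shift_invertible; rewrite ltrDl.
have bi : invertible (b + v%:C%:A) by apply: shift_invertible; rewrite ltrDl.
have h : T_ext ((a + u%:C%:A) * (b + v%:C%:A)) = T_ext (a + u%:C%:A) * T_ext (b + v%:C%:A).
  by rewrite !T_ext_invertible ?T_mul//; exact: invertibleM.
have e : (a + u%:C%:A) * (b + v%:C%:A) =
    a * b + (u%:C *: b + (v%:C *: a + (u * v)%:C%:A)).
  rewrite [u%:C *: b]scaleAE [v%:C *: a]scaleAE real_scalarM.
  ring.
have T_ext1 : T_ext 1 = 1.
  by have := T_ext_scalar 1; rewrite !scale1r.
move: h; rewrite e !T_extD !T_extZ T_ext1 => h.
have e' : (T_ext a + u%:C%:A) * (T_ext b + v%:C%:A) =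
    T_ext a * T_ext b + (u%:C *: T_ext b + (v%:C *: T_ext a + (u * v)%:C%:A)).
  rewrite [u%:C *: T_ext b]scaleAE [v%:C *: T_ext a]scaleAE real_scalarM.
  ring.
by move: h; rewrite e' => /addIr.
Qed.

Lemma T_injective f g : invertible f -> invertible g -> T f = T g -> f = g.
Proof.
move=> fi gi fg; have gV := binv_invertible gi.
have [T_inv _ _ _] := T_preserver.
apply: (gelfand_inj ssA) => x.
have := T_le T_preserver fi gV (c := 0) _ x.
rewrite gelfand_binv// => h; apply/eqP; rewrite -subr_eq0; apply/eqP/cabs_eq0.
have gx := invertible_neq0 x gi.
have h0 : cabs (f$x / g$x - 1) = 0.
  apply/eqP; rewrite eq_le cabs_ge0 andbT; apply: h => y.
  rewrite (T_binvE T_preserver)// fg divff ?subrr ?cabs0//.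
  by apply: invertible_neq0; exact: T_inv.
have -> : f$x - g$x = (f$x / g$x - 1) * g$x by field.
by rewrite cabsM h0 mul0r.
Qed.

Lemma T_ext_real_alg_iso : real_alg_iso T_ext.
Proof.
have [_ T_surj _ _] := T_preserver.
have inj a b : T_ext a = T_ext b -> a = b.
  (* For [c = a - b], [T_ext c = 0] says [T (c + r) = r = T r] for a large [r], and [T] is injective
     on invertible elements. *)
  move=> ab; have c0 : T_ext (a - b) = 0.
    by rewrite T_extD -scaleN1r (_ : -1 = (-1)%:C :> R[i]) ?T_extZ ?ab ?rmorphN1 ?scaleN1r ?subrr// rmorphN1.
  have [r cr] := T_ext_shift (a - b); rewrite c0 => /esym/eqP.
  have r0 : r != 0 by rewrite gt_eqF//; apply: le_lt_trans cr; exact: nrm_ge0.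
  rewrite subr_eq0 -T_scalar// => /eqP /T_injective h.
  apply/eqP; rewrite -subr_eq0; apply/eqP; apply: (addIr r%:C%:A).
  by rewrite add0r h//; [exact: shift_invertible|exact: real_invertible].
have surj (b : B) : exists a, T_ext a = b.
  have b1 : nrm b < nrm b + 1 by rewrite ltrDl.
  have [f fi fE] := T_surj _ (shift_invertible b1).
  exists (f - (nrm b + 1)%:C%:A); rewrite T_extD T_ext_invertible// fE.
  by rewrite -scaleNr -rmorphN T_ext_scalar rmorphN scaleNr addrK.
have [g gE] := choice surj.
split; [|exact: T_extD|exact: T_extZ|exact: T_extM].
by exists g => // a; apply: inj; rewrite gE.
Qed.

End Extension.
(** * Duality *)

Section UniformClosure.
Context {R : realType} {A : comBanachAlgType R}.
Implicit Types (F G : max_ideal_space A -> cplx R) (x : max_ideal_space A).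

Lemma supnorm_le F (c : R) : (forall x, cabs (F x) <= c) -> supnorm F <= c.
Proof.
move=> h; have [x0 _] := @exists_character R A.
by apply: ge_sup => [|_ [x _ <-]]; [exists (cabs (F x0)); exists x0|exact: h].
Qed.

Lemma le_supnorm F (c : R) x : (forall x, cabs (F x) <= c) -> cabs (F x) <= supnorm F.
Proof.
by move=> h; apply: ub_le_sup; [exists c => _ [z _ <-]; exact: h|exists x].
Qed.

Lemma supnorm_ge0 F : 0 <= supnorm F.
Proof.
(* For an unbounded [F] the supremum takes its default value [0]. *)
rewrite /supnorm; have [h|h] := pselect (has_sup (range (cabs \o F))); last first.
  by rewrite sup_out.
have [x0 _] := @exists_character R A.
apply: le_trans (cabs_ge0 (F x0)) _; apply: ub_le_sup; [by case: h|by exists x0].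
Qed.

Lemma cl_bounded F : cl A F -> exists c : R, forall x, cabs (F x) <= c.
Proof. by move=> [Fc _]; exact: continuous_bounded. Qed.

Lemma supnorm_eq (Y : Type) F (G : Y -> cplx R) :
  (forall x, exists y, cabs (F x) = cabs (G y)) ->
  (forall y, exists x, cabs (F x) = cabs (G y)) -> supnorm F = supnorm G.
Proof.
move=> h1 h2; congr sup; apply/seteqP; split=> _ [x _ <-] /=.
  by have [y e] := h1 x; exists y => //=; rewrite e.
by have [y e] := h2 x; exists y.
Qed.

Lemma cl_gelfand a : cl A (gelfand a).
Proof.
split; first exact: gelfand_continuous.
move=> e e0; exists a; apply: le_lt_trans e0; apply: supnorm_le => x.
by rewrite subrr cabs0.
Qed.

Lemma cl_cst (z : cplx R) : cl A (fun=> z).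
Proof.
have -> : (fun=> z) = gelfand (z%:A : A) by apply/funext => x; rewrite gelfandA.
exact: cl_gelfand.
Qed.

Lemma cl_lin (z : cplx R) F G : cl A F -> cl A G -> cl A (fun x => z * F x + G x).
Proof.
move=> FA GA; have [Fc Fa] := FA; have [Gc Ga] := GA; split.
  exact: (continuous_addC (continuous_mulC (@continuous_cstC _ _ z) Fc) Gc).
move=> e e0; have k0 : 0 < 2 * (cabs z + 1) by rewrite mulr_gt0// ltr_wpDl ?cabs_ge0.
have [a ha] := Fa _ (divr_gt0 e0 k0).
have [b hb] := Ga _ (divr_gt0 e0 (ltr0n R 2)).
have bd H c x : cl A H -> cabs (H x - c$x) <= supnorm (fun x => H x - c$x).
  move=> /cl_bounded[k hk]; apply: (@le_supnorm (fun x => H x - c$x) (k + nrm c)) => y.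
  by apply: le_trans (cabsB _ _) _; rewrite lerD// gelfand_le_nrm.
exists (z *: a + b); set d := e / (2 * (cabs z + 1)) in ha.
apply: (@le_lt_trans _ _ (cabs z * supnorm (fun x => F x - a$x) +
    supnorm (fun x => G x - b$x))).
  apply: supnorm_le => x; rewrite gelfandD gelfandZ.
  have -> : z * F x + G x - (z * a$x + b$x) = z * (F x - a$x) + (G x - b$x) by ring.
  apply: le_trans (cabsD _ _) _; rewrite cabsM lerD ?bd// ler_wpM2l ?cabs_ge0//.
  exact: bd.
have : cabs z * supnorm (fun x => F x - a$x) <= cabs z * d.
  by rewrite ler_wpM2l ?cabs_ge0// ltW.
have : cabs z * d <= e / 2.
  have -> : e / 2 = (cabs z + 1) * d.
    by rewrite /d; field; rewrite gt_eqF// ltr_wpDl ?cabs_ge0.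
  by rewrite ler_wpM2r ?lerDl// divr_ge0// ltW.
lra.
Qed.

Lemma character_ext x x' : (forall a : A, a$x = a$x') -> x = x'.
Proof. by move=> h; apply: val_inj; apply/funext => a; exact: h. Qed.

End UniformClosure.

Lemma continuous_to_characters {R : realType} {A : comBanachAlgType R} {X : topologicalType}
    (f : X -> max_ideal_space A) :
  (forall a : A, continuous (fun y => a$(f y))) -> continuous f.
Proof.
move=> h; apply: (@continuous_comp_initial _ _ _ (set_val : set_type (@characters R A) -> {ptws A -> cplx R})).
move=> y; apply/(@pointwise_cvgP _ _ _ _ _) => a; exact: h.
Qed.

Section RealIsomorphism.
Context {R : realType} {A B : comBanachAlgType R} (S : A -> B).
Hypothesis S_iso : real_alg_iso S.

Let SD a b : S (a + b) = S a + S b. Proof. by case: S_iso. Qed.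
Let SZ (r : R) a : S (r%:C *: a) = r%:C *: S a. Proof. by case: S_iso. Qed.
Let SM a b : S (a * b) = S a * S b. Proof. by case: S_iso. Qed.

Lemma real_alg_iso1 : S 1 = 1.
Proof.
have [[g _ gK] _ _ _] := S_iso.
by rewrite -[LHS]mulr1 -{1}(gK 1) -SM mul1r gK.
Qed.

Lemma real_alg_iso_inv : exists2 S' : B -> A, real_alg_iso S' & cancel S S' /\ cancel S' S.
Proof.
have [[g gK Kg] _ _ _] := S_iso; exists g => //; split.
- by exists S.
- by move=> a b; apply: (can_inj gK); rewrite SD !Kg.
- by move=> r a; apply: (can_inj gK); rewrite SZ !Kg.
- by move=> a b; apply: (can_inj gK); rewrite SM !Kg.
Qed.

Definition orientation y : bool := (S 'i%C%:A)$y == 'i%C.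

(** By real homogeneity [S i] squares to [-1], so its values are [i] or [-i]. *)
Lemma orientationP y : (S 'i%C%:A)$y = conj_unless (orientation y) 'i%C.
Proof.
rewrite /orientation; case: eqP => //= ni.
have : (S 'i%C%:A)$y * (S 'i%C%:A)$y = -1.
  rewrite -gelfandM -SM -scaleAE scalerA -expr2 sqr_i.
  have -> : -1 *: 1 = (-1 : R)%:C *: 1 :> A by rewrite rmorphN1.
  by rewrite SZ real_alg_iso1 gelfandZ gelfand1 mulr1 rmorphN1.
move: (_$y) ni => J ni J2.
have : (J - 'i%C) * (J + 'i%C) = 0.
  have -> : (J - 'i%C) * (J + 'i%C) = J * J - 'i%C ^+ 2 by ring.
  by rewrite J2 (sqr_i R) subrr.
move/eqP; rewrite mulf_eq0 subr_eq0 addr_eq0 => /orP[/eqP//|/eqP ->].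
by apply/eqP; rewrite eq_complex /= oppr0 !eqxx.
Qed.

(** Evaluation at [y] after [S], conjugated when [S i] has the value [-i] there, is real-linear,
    multiplicative and sends [i] to [i]; it is therefore complex-linear. *)
Lemma dual_character y : exists x, forall a, (S a)$y = conj_unless (orientation y) (a$x).
Proof.
set s := orientation y.
have sK (w : cplx R) : conj_unless s (conj_unless s w) = w by case: (s) => //=; exact: conjcK.
have [||x xE] := @make_character R A (fun a => conj_unless s ((S a)$y)).
- move=> z a b; rewrite SD gelfandD conj_unlessD; congr (_ + _).
  have -> : z *: a = (complex.Re z)%:C *: a + (complex.Im z)%:C *: ('i%C%:A * a).
    by rewrite {1}[z]complexE scalerDl mulrC -scalerA -scaleAE.
  rewrite SD !SZ SM gelfandD !gelfandZ gelfandM orientationP -/s.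
  rewrite conj_unlessD !conj_unlessM sK !conj_unless_real mulrA -mulrDl.
  by congr (_ * _); rewrite [RHS]complexE mulrC.
- by split; [rewrite real_alg_iso1 gelfand1 -(rmorph1 (real_complex R)) conj_unless_real|
    move=> a b; rewrite SM gelfandM conj_unlessM].
by exists x => a; rewrite xE sK.
Qed.

End RealIsomorphism.
Lemma conj_unlessK {R : realType} s : involutive (@conj_unless R s).
Proof. by case: s => // w; exact: conjcK. Qed.

Lemma conj_unless_inj {R : realType} s s' :
  conj_unless s ('i%C : cplx R) = conj_unless s' 'i%C -> s = s'.
Proof.
by case: s; case: s' => //= /eqP; rewrite eq_complex /= -?(eqr_oppLR 1) ?eqxx /=;
  rewrite -subr_eq0 ?opprK -?opprD ?oppr_eq0 -[1 + 1]/2%:R pnatr_eq0.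
Qed.

Definition semi_comp {R : realType} {X Y : Type} (phi : Y -> X) (s : Y -> bool)
  (F : X -> cplx R) : Y -> cplx R := fun y => conj_unless (s y) (F (phi y)).

Section Composition.
Context {R : realType} {A B : comBanachAlgType R} (S : A -> B).
Context (phi : max_ideal_space B -> max_ideal_space A).
Context (psi : max_ideal_space A -> max_ideal_space B).
Context (s : max_ideal_space B -> bool).
Hypothesis phiK : cancel phi psi.
Hypothesis psiK : cancel psi phi.
Hypothesis SE : forall a y, (S a)$y = conj_unless (s y) (a$(phi y)).
Implicit Types (F : max_ideal_space A -> cplx R) (G : max_ideal_space B -> cplx R).

Local Notation U := (@semi_comp R _ _ phi s).
Local Notation U' := (@semi_comp R _ _ psi (s \o psi)).

Lemma semi_compK : cancel U U'.
Proof. by move=> F; apply/funext => x; rewrite /semi_comp /= psiK conj_unlessK. Qed.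

Lemma semi_compVK : cancel U' U.
Proof. by move=> G; apply/funext => y; rewrite /semi_comp /= phiK conj_unlessK. Qed.

Lemma semi_comp_gelfand a : U (gelfand a) = gelfand (S a).
Proof. by apply/funext => y; rewrite SE. Qed.

Let turn_continuous : continuous (fun y => conj_unless (s y) ('i%C : cplx R)).
Proof.
have -> : (fun y => conj_unless (s y) ('i%C : cplx R)) = gelfand (S 'i%C%:A).
  by apply/funext => y; rewrite SE gelfandA.
exact: gelfand_continuous.
Qed.

(** The set and its complement are the zero sets of the continuous functions [S i - i] and
    [S i + i]. *)
Lemma clopen_orientation : clopen [set y | s y].
Proof.
have cl0 z := closed_zeros (continuous_addC turn_continuous (@continuous_cstC _ _ z)).
split; last first.
  have -> : [set y | s y] = [set y | conj_unless (s y) ('i%C : cplx R) + - 'i%C = 0].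
    apply/seteqP; split=> y /=; first by move=> ->; rewrite subrr.
    by move/eqP; rewrite subr_eq0 => /eqP/(@conj_unless_inj _ _ true) ->.
  exact: cl0.
rewrite -[X in open X]setCK openC.
have -> : ~` [set y | s y] = [set y | conj_unless (s y) ('i%C : cplx R) + 'i%C = 0].
  apply/seteqP; split=> y /=; case: (s y) => //=.
  - by move=> _; apply/eqP; rewrite eq_complex /= addr0 addNr eqxx.
  - move=> /eqP; rewrite eq_complex /= => /andP[_].
    by rewrite -[1 + 1]/2%:R pnatr_eq0.
exact: cl0.
Qed.

Lemma conj_unless_continuous G : continuous G ->
  continuous (fun y => conj_unless (s y) (G y)).
Proof.
(* [e] is the indicator function of [s], continuous as an affine function of the transform of
   [S i]. *)
move=> Gc; pose e y : cplx R := (2^-1)%:C * (1 + - ('i%C * conj_unless (s y) 'i%C)).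
have ec : continuous e.
  apply: (continuous_mulC (@continuous_cstC _ _ _) (continuous_addC (@continuous_cstC _ _ _) _)).
  exact: (continuous_oppC (continuous_mulC (@continuous_cstC _ _ _) turn_continuous)).
have -> : (fun y => conj_unless (s y) (G y)) =
    (fun y => e y * G y + (1 + - e y) * (G y)^*).
  apply/funext => y; rewrite /e.
  have h : (2^-1)%:C * (1 + 1) = 1 :> cplx R.
    rewrite -(rmorph1 (real_complex R)) -rmorphD -rmorphM; congr (_%:C).
    by field.
  case: (s y) => /=.
    by rewrite -expr2 (sqr_i R) opprK h mul1r subrr mul0r addr0.
  have -> : ('i%C)^* = - 'i%C :> cplx R by apply/eqP; rewrite eq_complex /= oppr0 !eqxx.
  by rewrite mulrN -expr2 (sqr_i R) opprK subrr mulr0 mul0r add0r subr0 mul1r.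
apply: (continuous_addC (continuous_mulC ec Gc)).
apply: (continuous_mulC _ (continuous_conjC Gc)).
exact: (continuous_addC (@continuous_cstC _ _ _) (continuous_oppC ec)).
Qed.

Lemma dual_continuous : continuous phi.
Proof.
apply: continuous_to_characters => a.
have -> : (fun y => a$(phi y)) = (fun y => conj_unless (s y) ((S a)$y)).
  by apply/funext => y; rewrite SE conj_unlessK.
apply: conj_unless_continuous; exact: gelfand_continuous.
Qed.

Lemma supnorm_semi_comp F : supnorm (U F) = supnorm F.
Proof.
apply: supnorm_eq => [y|x]; first by exists (phi y); rewrite /semi_comp cabs_conj_unless.
by exists (psi x); rewrite /semi_comp psiK cabs_conj_unless.
Qed.

Lemma cl_semi_comp F : cl A F -> cl B (U F).
Proof.
move=> [Fc Fa]; split.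
  apply: conj_unless_continuous => y; apply: continuous_comp; last exact: Fc.
  exact: dual_continuous.
move=> e e0; have [a ha] := Fa e e0; exists (S a).
rewrite -(supnorm_semi_comp (fun x => F x - a$x)) in ha.
rewrite (_ : (fun y => _) = U (fun x => F x - a$x))//.
apply/funext => y; rewrite SE /semi_comp.
by case: (s y) => //=; rewrite rmorphB.
Qed.

End Composition.

(** * Transport of states and of the Choquet boundary *)

Section ChoquetTransport.
Context {R : realType} {A B : comBanachAlgType R} (S : A -> B) (S' : B -> A).
Context (phi : max_ideal_space B -> max_ideal_space A).
Context (psi : max_ideal_space A -> max_ideal_space B).
Context (s : max_ideal_space B -> bool).
Hypothesis phiK : cancel phi psi.
Hypothesis psiK : cancel psi phi.
Hypothesis SE : forall a y, (S a)$y = conj_unless (s y) (a$(phi y)).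
Hypothesis S'E : forall b x, (S' b)$x = conj_unless (s (psi x)) (b$(psi x)).
Implicit Types (F : max_ideal_space A -> cplx R) (G : max_ideal_space B -> cplx R).

Local Notation U := (@semi_comp R _ _ phi s).
Local Notation U' := (@semi_comp R _ _ psi (s \o psi)).
Local Notation stateA := ((max_ideal_space A -> cplx R) -> cplx R).

Let cl_U F : cl A F -> cl B (U F).
Proof. exact: (cl_semi_comp psiK SE). Qed.

Let cl_U' G : cl B G -> cl A (U' G).
Proof. exact: (@cl_semi_comp _ _ _ S' psi phi (s \o psi) phiK S'E). Qed.

Let UK : cancel U U' := semi_compK s psiK.
Let U'K : cancel U' U := semi_compVK s phiK.

(** [U'] is only real-linear, so only the real part of a state is carried over; [push] rebuilds the
    imaginary part. *)
Let ReL (L : stateA) G := complex.Re (L (U' G)).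

Let ReL_lin (L : stateA) (r : R) G H : state (cl A) L -> cl B G -> cl B H ->
  ReL L (fun y => r%:C * G y + H y) = r * ReL L G + ReL L H.
Proof.
move=> [Llin _ _] GB HB; rewrite /ReL.
have -> : U' (fun y => r%:C * G y + H y) = (fun x => r%:C * U' G x + U' H x).
  apply/funext => x; rewrite /semi_comp conj_unlessD conj_unlessM.
  by rewrite conj_unless_real.
rewrite Llin; [|exact: cl_U'|exact: cl_U'].
by case: (L (U' G)) (L (U' H)) => a b [c d] /=; ring.
Qed.

(* The complex-linear functional with real part [G |-> Re L(U' G)]. *)
Let push (L : stateA) G : cplx R :=
  ReL L G +i* (- ReL L (fun y => 'i%C * G y)).

Let cl_scale (z : cplx R) G : cl B G -> cl B (fun y => z * G y).
Proof.
move=> GB; have := cl_lin z GB (cl_cst 0); congr (cl B _).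
by apply/funext => y; rewrite addr0.
Qed.

Let push_lin (L : stateA) (z : cplx R) G H : state (cl A) L -> cl B G -> cl B H ->
  push L (fun y => z * G y + H y) = z * push L G + push L H.
Proof.
move=> Ls GB HB; case: z => p q.
pose iG y := 'i%C * G y; pose iH y := 'i%C * H y.
have iGB : cl B iG by exact: cl_scale.
have iHB : cl B iH by exact: cl_scale.
have e1 : (fun y => (p +i* q) * G y + H y) =
    (fun y => p%:C * G y + (q%:C * iG y + H y)).
  apply/funext => y; rewrite /iG (complexE (p +i* q)) /=; ring.
have e2 : (fun y => 'i%C * ((p +i* q) * G y + H y)) =
    (fun y => p%:C * iG y + ((- q)%:C * G y + iH y)).
  apply/funext => y; rewrite /iG /iH; case: (G y) => a b; case: (H y) => c d.
  by apply/eqP; rewrite eq_complex /=; apply/andP; split; apply/eqP; ring.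
rewrite /push e2 e1 !ReL_lin//; try exact: cl_lin.
rewrite -/iG -/iH; move: (ReL L G) (ReL L iG) (ReL L H) (ReL L iH) => a b c d.
by apply/eqP; rewrite eq_complex /=; apply/andP; split; apply/eqP; ring.
Qed.

(** This makes [push L] take the value [1] at [1]. As [U' i] has values [i] and [-i], the function
    [t + U' i] has modulus [sqrt (1 + t ^+ 2)] for real [t]; hence [(p + t) ^+ 2 <= 1 + t ^+ 2] for
    all [t], which fails at [t = p^-1] unless [p = 0]. *)
Let ReL_i (L : stateA) : state (cl A) L -> ReL L (fun=> 'i%C) = 0.
Proof.
move=> Ls; have [Llin L1 Lle] := Ls; set p := ReL L _.
have key (t : R) : (p + t) ^+ 2 <= 1 + t ^+ 2.
  pose f := fun x => t%:C * 1 + U' (fun=> 'i%C) x : cplx R.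
  have fA : cl A f by apply: cl_lin; [exact: cl_cst|apply: cl_U'; exact: cl_cst].
  have Lf : L f = t%:C + L (U' (fun=> 'i%C)).
    by rewrite /f Llin ?L1 ?mulr1//; [exact: cl_cst|apply: cl_U'; exact: cl_cst].
  have h1 : supnorm f <= Num.sqrt (1 + t ^+ 2).
    apply: supnorm_le => x; apply: cabs_le; first exact: sqrtr_ge0.
    rewrite sqr_sqrtr; last by rewrite addr_ge0 ?sqr_ge0.
    by rewrite /f /semi_comp /=; case: (s (psi x)) => /=; lra.
  have h2 : cabs (L f) <= Num.sqrt (1 + t ^+ 2) by apply: le_trans h1; exact: Lle.
  have := le_cabs (sqrtr_ge0 _) h2; rewrite sqr_sqrtr; last by rewrite addr_ge0 ?sqr_ge0.
  rewrite Lf raddfD /= -[complex.Re (L _)]/p => h3.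
  have := sqr_ge0 (complex.Im (t%:C + L (U' (fun=> 'i%C)))); lra.
apply/eqP; apply: contraT => p0.
have := key p^-1; have := sqr_ge0 p.
have -> : (p + p^-1) ^+ 2 = p ^+ 2 + 2 + p^-1 ^+ 2 by field.
lra.
Qed.

(** For the norm, [G] is rotated by a unimodular [c] that makes the value real and nonnegative; it
    then equals a real part, which the bound on [L] controls because [U'] preserves the supremum
    norm. *)
Let state_push (L : stateA) : state (cl A) L -> state (cl B) (push L).
Proof.
move=> Ls; have [Llin L1 Lle] := Ls; split.
- by move=> z G H GB HB; exact: push_lin.
- have -> : push L (fun=> 1) = ReL L (fun=> 1) +i* (- ReL L (fun=> 'i%C)).
    by rewrite /push; congr (_ +i* (- ReL L _)); apply/funext => y; rewrite mulr1.
  rewrite ReL_i// oppr0 /ReL.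
  have -> : U' (fun=> 1) = (fun=> 1).
    by apply/funext => x; rewrite /semi_comp -(rmorph1 (real_complex R)) conj_unless_real.
  by rewrite L1.
move=> G GB; set w := push L G.
have [w0|w0] := eqVneq w 0; first by rewrite w0 cabs0; exact: supnorm_ge0.
pose c : cplx R := (cabs w)%:C / w.
have cw : cabs c = 1.
  by rewrite /c cabsM cabsV cabs_real ger0_norm ?cabs_ge0// divff// gt_eqF// cabs_gt0.
have zero : push L (fun=> 0) = 0.
  have e : push L (fun=> 0) = 1 * push L (fun=> 0) + push L (fun=> 0).
    rewrite -push_lin//; [|exact: cl_cst|exact: cl_cst].
    by congr (push L _); apply/funext => y; rewrite mulr0 addr0.
  by move/eqP: e; rewrite mul1r -subr_eq0 opprD addNKr oppr_eq0 => /eqP.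
have e : push L (fun y => c * G y) = (cabs w)%:C.
  have -> : (cabs w)%:C = c * push L G + push L (fun=> 0).
    by rewrite zero addr0 -/w /c divfK.
  rewrite -push_lin//; last exact: cl_cst.
  by congr (push L _); apply/funext => y; rewrite addr0.
have -> : cabs w = ReL L (fun y => c * G y).
  by move: e => /(congr1 (@complex.Re R)).
apply: le_trans (Re_le_cabs _) _.
apply: le_trans (Lle _ _) _; first by apply: cl_U'; exact: cl_scale.
rewrite le_eqVlt; apply/orP; left; apply/eqP; apply: supnorm_eq => [x|y].
  by exists (psi x); rewrite /semi_comp cabs_conj_unless cabsM cw mul1r.
by exists (phi y); rewrite /semi_comp cabs_conj_unless cabsM cw mul1r phiK.
Qed.

(** A convex decomposition of the evaluation at [phi y] is pushed to one of the evaluation at [y],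
    where extremality applies. *)
Lemma Choquet_transport y : Choquet_boundary (cl B) y -> Choquet_boundary (cl A) (phi y).
Proof.
move=> yCh L1 L2 t L1s L2s t01 decomp.
have Re_decomp G : cl B G ->
    complex.Re (G y) = t * ReL L1 G + (1 - t) * ReL L2 G.
  move=> GB; have := decomp _ (cl_U' GB); rewrite {1}/semi_comp /= phiK.
  move=> /(congr1 (@complex.Re R)).
  have -> : complex.Re (conj_unless (s y) (G y)) = complex.Re (G y).
    by case: (s y) => //=; case: (G y).
  move=> ->; rewrite /ReL; case: (L1 _) (L2 _) => a b [c d] /=; ring.
have push_decomp G : cl B G -> G y = t%:C * push L1 G + (1 - t)%:C * push L2 G.
  move=> GB; have h1 := Re_decomp _ GB; have h2 := Re_decomp _ (cl_scale 'i%C GB).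
  rewrite /push; move: h1 h2; set a := ReL L1 _; set b := ReL L1 _.
  set c := ReL L2 _; set d := ReL L2 _; case: (G y) => u v /= h1 h2.
  by apply/eqP; rewrite eq_complex /=; apply/andP; split; apply/eqP; lra.
have h := yCh _ _ t (state_push L1s) (state_push L2s) t01 push_decomp.
(* A complex-linear functional is determined by its real part: the imaginary part of [L F] is minus
   the real part of [L] at ['i * F]. *)
have recover (L : stateA) : state (cl A) L -> (forall G, cl B G -> push L G = G y) ->
    forall F, cl A F -> L F = F (phi y).
  move=> [Llin L1' _] hL F FA.
  have Re_eq H : cl A H -> complex.Re (L H) = complex.Re (H (phi y)).
    move=> HA; have := hL _ (cl_U HA) => /(congr1 (@complex.Re R)) /=.
    rewrite /ReL UK => ->; rewrite /semi_comp; case: (s y) => //=.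
    by case: (H (phi y)).
  have iFA : cl A (fun x => 'i%C * F x + 0) by apply: cl_lin => //; exact: cl_cst.
  have L0 : L (fun=> 0) = 0.
    have e : L (fun=> 0) = 1 * L (fun=> 0) + L (fun=> 0).
      rewrite -Llin//; [|exact: cl_cst|exact: cl_cst].
      by congr (L _); apply/funext => x; rewrite mulr0 addr0.
    by move/eqP: e; rewrite mul1r -subr_eq0 opprD addNKr oppr_eq0 => /eqP.
  have h1 := Re_eq _ FA; have := Re_eq _ iFA.
  rewrite Llin//; last exact: cl_cst.
  rewrite L0 !addr0; move: h1; case: (L F) (F (phi y)) => a b [c d] /= -> h2.
  by apply/eqP; rewrite eq_complex /= eqxx /=; apply/eqP; lra.
move=> F FA; split.
  by apply: recover => // G GB; case: (h G GB).
by apply: recover => // G GB; case: (h G GB).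
Qed.

End ChoquetTransport.
Lemma set_val_continuous {X : topologicalType} (D : set X) :
  continuous (set_val : D -> X).
Proof. exact: initial_continuous. Qed.

Lemma continuous_restrict {X Y : topologicalType} (D : set X) (E : set Y)
    (f : X -> Y) (g : D -> E) : continuous f ->
  (forall x, set_val (g x) = f (set_val x)) -> continuous g.
Proof.
move=> fc gE; apply: (@continuous_comp_initial _ _ _ (set_val : E -> Y)).
have -> : set_val \o g = f \o set_val by apply/funext => x; exact: gE.
move=> x; apply: (@continuous_comp _ _ _ (set_val : D -> X) f); last exact: fc.
exact: set_val_continuous.
Qed.

(** * Semisimplicity of the codomain and normalization at [1] *)

Section Normalization.
Context {R : realType} {A B : comBanachAlgType R} (T : A -> B).
Hypothesis ssA : @semisimple R A.
Hypothesis T_onto : T @` @invertible R A = @invertible R B.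
Hypothesis T_radius : forall f g : A, invertible f -> invertible g ->
  spectral_radius (T f * T g - 1) = spectral_radius (f * g - 1).

Let T_inv f : invertible f -> invertible (T f).
Proof. by move=> fi; rewrite -T_onto; exists f. Qed.

Let T_surj g : invertible g -> exists2 f, invertible f & T f = g.
Proof. by rewrite -T_onto => -[f]; exists f. Qed.

Lemma spectral_radius_eq0 (C : comBanachAlgType R) (a : C) x :
  spectral_radius a = 0 -> a$x = 0.
Proof.
move=> a0; apply: cabs_eq0; apply/eqP; rewrite eq_le cabs_ge0 andbT -a0.
exact: gelfand_le.
Qed.

Lemma spectral_radius0 (C : comBanachAlgType R) : spectral_radius (0 : C) = 0.
Proof.
have [x _] := @exists_character R C.
apply/eqP; rewrite eq_le; apply/andP; split.
  by apply: spectral_radius_le => y; rewrite gelfand0 cabs0.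
by apply: le_trans (cabs_ge0 _) (gelfand_le 0 x).
Qed.

(** The spectral radius depends on Gelfand transforms only, so [f * binv g - 1] has the same radius
    as [g * binv g - 1 = 0]. *)
Lemma T_gelfand_injective f g : invertible f -> invertible g ->
  gelfand (T f) = gelfand (T g) -> f = g.
Proof.
move=> fi gi e; have gV := binv_invertible gi.
have h : spectral_radius (f * binv g - 1) = 0.
  transitivity (spectral_radius (g * binv g - 1)).
    rewrite -!T_radius//.
    by apply: eq_spectral_radius; apply/funext => y; rewrite !gelfandM_sub1 e.
  by rewrite mulr_binv// subrr spectral_radius0.
apply: (gelfand_inj ssA) => x; have := spectral_radius_eq0 x h.
rewrite gelfandM_sub1 gelfand_binv// => k; have gx := invertible_neq0 x gi.
apply/eqP; rewrite -subr_eq0; have -> : f$x - g$x = (f$x / g$x - 1) * g$x by field.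
by rewrite k mul0r.
Qed.

(** If the transform of [b] vanishes, [1 + b] and [1] are invertible with equal transforms; their
    preimages coincide, hence [b = 0]. *)
Lemma codomain_semisimple : @semisimple R B.
Proof.
apply/semisimpleP => b b0.
have bi : invertible (1 + b).
  by apply/invertibleP => y; rewrite gelfandD gelfand1 b0 addr0 oner_eq0.
have [f fi Tf] := T_surj bi; have [g gi Tg] := T_surj (@invertible1 R B).
have fg : f = g.
  apply: T_gelfand_injective => //; apply/funext => y.
  by rewrite Tf Tg gelfandD b0 addr0.
by move: Tf; rewrite fg Tg => /eqP; rewrite -subr_eq0 opprD addNKr oppr_eq0 => /eqP.
Qed.

Lemma T1_sqr : T 1 ^+ 2 = 1.
Proof.
apply: (gelfand_inj codomain_semisimple) => y.
have i1 := @invertible1 R A.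
have h : spectral_radius (T 1 * T 1 - 1) = 0.
  by rewrite T_radius// mulr1 subrr spectral_radius0.
have := spectral_radius_eq0 y h; rewrite gelfandM_sub1 => /eqP.
by rewrite subr_eq0 expr2 gelfandM gelfand1 => /eqP.
Qed.

Lemma normalized_preserver : radius_preserver (fun f => T 1 * T f).
Proof.
have sq := T1_sqr; have i1 := T_inv (@invertible1 R A); split.
- by move=> f fi; apply: invertibleM => //; exact: T_inv.
- move=> g gi; have [f fi Tf] := T_surj (invertibleM i1 gi).
  by exists f => //; rewrite Tf mulrA -expr2 sq mul1r.
- by rewrite -expr2.
- move=> f g fi gi; rewrite mulrACA -expr2 sq mul1r; exact: T_radius.
Qed.

End Normalization.

Section Main.
Context {R : realType} {A B : comBanachAlgType R} (S : A -> B).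
Hypothesis S_iso : real_alg_iso S.

(** Applying [S' S] and [S S'] to [i] shows that the orientations of [S] and [S'] correspond at dual
    points; the conjugations then cancel and the two dual maps are mutually inverse. *)
Lemma dual_homeomorphism : exists (S' : B -> A) (phi : max_ideal_space B -> max_ideal_space A)
    (psi : max_ideal_space A -> max_ideal_space B) (s : max_ideal_space B -> bool),
  [/\ cancel S S' /\ cancel S' S, cancel phi psi, cancel psi phi,
      forall a y, (S a)$y = conj_unless (s y) (a$(phi y))
    & forall b x, (S' b)$x = conj_unless (s (psi x)) (b$(psi x))].
Proof.
have [S' S'_iso [SK S'K]] := real_alg_iso_inv S_iso.
have [phi phiE] := choice (dual_character S_iso).
have [psi psiE] := choice (dual_character S'_iso).
have turn x : orientation S (psi x) = orientation S' x.
  apply: (@conj_unless_inj R); rewrite -(orientationP S_iso).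
  by rewrite -[LHS](conj_unlessK (orientation S' x)) -psiE SK gelfandA.
have turn' y : orientation S' (phi y) = orientation S y.
  apply: (@conj_unless_inj R); rewrite -(orientationP S'_iso).
  by rewrite -[LHS](conj_unlessK (orientation S y)) -phiE S'K gelfandA.
exists S', phi, psi, (orientation S); split=> //.
- move=> y; apply: character_ext => b.
  by rewrite -[LHS](conj_unlessK (orientation S' (phi y))) -psiE turn' -phiE S'K.
- move=> x; apply: character_ext => a.
  by rewrite -[LHS](conj_unlessK (orientation S (psi x))) -phiE turn -psiE SK.
- by move=> b x; rewrite turn psiE.
Qed.

End Main.

Theorem corollary5p13 (R : realType) (A B : comBanachAlgType R) (T : A -> B)
    (ssA : semisimple A)
    (T_onto : T @` @invertible R A = @invertible R B)
    (T_radius : forall f g : A, invertible f -> invertible g ->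
       spectral_radius (T f * T g - 1) = spectral_radius (f * g - 1)) :
  semisimple B /\
  (T 1) ^+ 2 = 1 /\
  exists TE : (max_ideal_space A -> cplx R) -> (max_ideal_space B -> cplx R),
    (forall f : A, invertible f -> TE (gelfand f) = gelfand (T f)) /\
    TE @` cl A = cl B /\
    TE @` range (@gelfand R A) = range (@gelfand R B) /\
    (exists (phi : Choquet_boundary (cl B) -> Choquet_boundary (cl A))
            (K : set (Choquet_boundary (cl B))),
       homeomorphism phi /\ clopen K /\
       forall F, cl A F -> forall y : Choquet_boundary (cl B),
         (K y -> TE F (set_val y) =
            gelfand (T 1) (set_val y) * F (set_val (phi y))) /\
         (~ K y -> TE F (set_val y) =
            gelfand (T 1) (set_val y) * (F (set_val (phi y)))^*)) /\
    let S := fun F y => TE F y / gelfand (T 1) y in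
    real_alg_iso_on (cl A) (cl B) S /\
    S @` range (@gelfand R A) = range (@gelfand R B) /\
    (exists Phi : A -> B, real_alg_iso Phi) /\
    (forall F G, cl A F -> cl A G ->
       supnorm (fun y => TE F y * TE G y - 1) =
       supnorm (fun x => F x * G x - 1)) /\
    TE @` fun_invertible (cl A) = fun_invertible (cl B).
Proof.
have ssB := codomain_semisimple ssA T_onto T_radius.
have sq := T1_sqr ssA T_onto T_radius.
have T0_pres := normalized_preserver ssA T_onto T_radius.
split=> //; split=> //.
pose S := T_ext (fun f => T 1 * T f).
have S_iso : real_alg_iso S := T_ext_real_alg_iso ssA ssB T0_pres.
have SE_inv f : invertible f -> S f = T 1 * T f by exact: (T_ext_invertible ssB T0_pres).
have [S' [phi [psi [s [[SK S'K] phiK psiK SE S'E]]]]] := dual_homeomorphism S_iso.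
pose U := @semi_comp R _ _ phi s; pose U' := @semi_comp R _ _ psi (s \o psi).
have UK : cancel U U' := semi_compK s psiK.
have U'K : cancel U' U := semi_compVK s phiK.
have clU F : cl A F -> cl B (U F) by exact: (cl_semi_comp psiK SE).
have clU' G : cl B G -> cl A (U' G) by exact: (@cl_semi_comp _ _ _ S' psi phi (s \o psi) phiK S'E).
have Ug a : U (gelfand a) = gelfand (S a) by exact: (semi_comp_gelfand SE).
pose m y := (T 1)$y.
have mm y : m y * m y = 1 by rewrite /m -gelfandM -expr2 sq gelfand1.
have m0 y : m y != 0.
  by apply/eqP => e; have := mm y; rewrite e mul0r => /esym/eqP; rewrite oner_eq0.
have cm y : cabs (m y) = 1.
  have := congr1 cabs (mm y); rewrite cabsM cabs1 => e.
  by apply/eqP; rewrite -sqrp_eq1 ?cabs_ge0// expr2 e.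
have clm G : cl B G -> cl B (fun y => m y * G y).
  move=> [Gc Ga]; split.
    by apply: (continuous_mulC _ Gc); exact: gelfand_continuous.
  move=> e e0; have [b hb] := Ga e e0; exists (T 1 * b).
  apply: le_lt_trans hb; rewrite le_eqVlt; apply/orP; left; apply/eqP.
  by apply: supnorm_eq => y; exists y; rewrite gelfandM -mulrBr cabsM cm mul1r.
(* On invertible elements [S f = T 1 * T f], and [T 1] squares to [1], so [T f = T 1 * S f];
   multiplication by [T 1] also undoes itself in the inverse of [TE]. *)
pose TE F y := m y * U F y.
exists TE.
have TE_S F : (fun y => TE F y / gelfand (T 1) y) = U F.
  by apply/funext => y; rewrite /TE mulrC mulrA -/(m y) mulVf// mul1r.
have UM F G : U (fun x => F x * G x) = (fun y => U F y * U G y).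
  by apply/funext => y; rewrite /U /semi_comp conj_unlessM.
have U1 : U (fun=> 1) = (fun=> 1).
  by apply/funext => y; rewrite /U /semi_comp -(rmorph1 (real_complex R)) conj_unless_real.
have U'M F G : U' (fun x => F x * G x) = (fun y => U' F y * U' G y).
  by apply/funext => y; rewrite /U' /semi_comp conj_unlessM.
have U'1 : U' (fun=> 1) = (fun=> 1).
  by apply/funext => y; rewrite /U' /semi_comp -(rmorph1 (real_complex R)) conj_unless_real.
have TE_surj G : TE (U' (fun y => m y * G y)) = G.
  by apply/funext => y; rewrite /TE U'K mulrA mm mul1r.
split; [|split; [|split; [|split]]].
- move=> f fi; apply/funext => y; rewrite /TE Ug SE_inv// gelfandM mulrA mm mul1r.
  by [].
- apply/seteqP; split=> [_ [F FA <-]|G GB]; first by apply: clm; exact: clU.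
  by exists (U' (fun y => m y * G y)) => //; apply: clU'; exact: clm.
- apply/seteqP; split=> [_ [_ [a _ <-] <-]|_ [b _ <-]].
    by exists (T 1 * S a) => //; apply/funext => y; rewrite /TE Ug gelfandM.
  exists (gelfand (S' (T 1 * b))); first by exists (S' (T 1 * b)).
  by apply/funext => y; rewrite /TE Ug S'K gelfandM mulrA mm mul1r.
- have ChA y : Choquet_boundary (cl B) y -> Choquet_boundary (cl A) (phi y).
    exact: (Choquet_transport phiK psiK SE S'E).
  have ChB x : Choquet_boundary (cl A) x -> Choquet_boundary (cl B) (psi x).
    apply: (@Choquet_transport _ _ _ S' S psi phi (s \o psi) psiK phiK S'E).
    by move=> a y; rewrite /= phiK SE.
  pose phi' (y : Choquet_boundary (cl B)) : Choquet_boundary (cl A) :=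
    SigSub (mem_set (ChA _ (set_valP y))).
  pose psi' (x : Choquet_boundary (cl A)) : Choquet_boundary (cl B) :=
    SigSub (mem_set (ChB _ (set_valP x))).
  exists phi', [set y | s (set_val y)]; split; [|split].
  + split.
      exact: (@continuous_restrict _ _ _ _ phi phi' (dual_continuous SE)).
    exists psi'; split.
    * exact: (@continuous_restrict _ _ _ _ psi psi' (@dual_continuous _ _ _ S' psi (s \o psi) S'E)).
    * by move=> y; apply: val_inj; rewrite /= phiK.
    * by move=> x; apply: val_inj; rewrite /= psiK.
  + exact: (preimage_clopen (clopen_orientation SE) (@set_val_continuous _ _)).
  + move=> F FA y; rewrite /TE /U /semi_comp /=.
    by split=> [->|/negP/negbTE ->].
move=> S0; have S0E F : S0 F = U F by exact: TE_S.
split; [|split; [|split; [|split]]].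
- split.
  + split.
    * by move=> F FA; rewrite S0E; exact: clU.
    * by move=> F G _ _; rewrite !S0E => /(can_inj UK).
    * by move=> G GB; exists (U' G); [exact: clU'|rewrite S0E U'K].
  + move=> F G _ _; rewrite !S0E; apply/funext => y.
    by rewrite /U /semi_comp conj_unlessD.
  + move=> r F _; rewrite !S0E; apply/funext => y.
    by rewrite /U /semi_comp conj_unlessM conj_unless_real.
  + by move=> F G _ _; rewrite !S0E UM.
- apply/seteqP; split=> [_ [_ [a _ <-] <-]|_ [b _ <-]].
    by exists (S a) => //; rewrite S0E Ug.
  by exists (gelfand (S' b)); [exists (S' b)|rewrite S0E Ug S'K].
- by exists S.
- move=> F G FA GA; have e y : TE F y * TE G y - 1 = conj_unless (s y) (F (phi y) * G (phi y) - 1).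
    rewrite /TE mulrACA mm mul1r /U /semi_comp -conj_unlessM.
    by case: (s y) => //=; rewrite rmorphB rmorph1.
  apply/esym/supnorm_eq => [x|y]; last by exists (phi y); rewrite e cabs_conj_unless.
  by exists (psi x); rewrite e cabs_conj_unless psiK.
apply/seteqP; split=> [_ [F [FA [G GA FG]] <-]|G [GB [H HB GH]]].
  split; first by apply: clm; exact: clU.
  exists (TE G); first by apply: clm; exact: clU.
  move=> y; rewrite /TE mulrACA mm mul1r /U /semi_comp -conj_unlessM FG.
  by rewrite -(rmorph1 (real_complex R)) conj_unless_real.
exists (U' (fun y => m y * G y)) => //; split; first by apply: clU'; exact: clm.
exists (U' (fun y => m y * H y)); first by apply: clU'; exact: clm.
move=> x; rewrite /U' /semi_comp -conj_unlessM mulrACA mm mul1r GH.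
by rewrite -(rmorph1 (real_complex R)) conj_unless_real.
Qed.
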